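(* For all integers $l\ge 1$ and $n\ge 0$, with $N=n+\tfrac34$, $$(-1)^{l+1}\,\varepsilon_l(N)>0,$$ where $$\varepsilon_l(N)=\pi G_n-\left\{\ln N+\gamma+4\ln 2+\sum_{s=1}^{l-1}\frac{\beta_{2s}}{N^{2s}}\right\},$$ $G_n$ is the $n$-th Landau constant, $\gamma$ is Euler's constant, and the numbers $\beta_{2s}$ are those defined recursively in the context.
   Context: Landau constants: $G_0=1$ and, for $n\ge1$, $$G_n=1+\left(\frac12\right)^2+\left(\frac{1\cdot3}{2\cdot4}\right)^2+\cdots+\left(\frac{1\cdot3\cdots(2n-1)}{2\cdot4\cdots(2n)}\right)^2.$$ Euler's constant is $\gamma=0.5772\cdots$. An empty sum (the case $l=1$) is $0$. Coefficients $d_{j,s}$: for integers $j\ge1$, $d_{j,j+1}=4j^2$ and, for $s\ge j+2$, $$d_{j,s}=\frac{(2s+2j-2)\,(2s-2)!}{(2s-2j)!\,(2j-1)!}+\frac{(2s-3)!}{8\,(2s-2j-2)!\,(2j-1)!};$$ and for $s\ge2$, $$d_{0,s}=\left(\frac1s-\frac1{2s-1}\right)+\frac1{16(s-1)}.$$ The numbers $\beta_{2k}$ ($k=1,2,\dots$) are defined recursively by $$\beta_{2k}=\frac{-1}{4k^2}\left(\sum_{j=1}^{k-1}d_{j,k+1}\,\beta_{2j}-d_{0,k+1}\right),$$ so e.g. $\beta_2=\frac{11}{192}$, $\beta_4=-\frac{1541}{122880}$. *)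

(* Defs.v *)
From Stdlib Require Import Reals Arith Lra Lia.
From Coquelicot Require Import Coquelicot.
Open Scope R_scope.

(* Stdlib's real numbers, with Coquelicot's limits and sums.  A sum
   [sum_n_m f a b] with [b < a] is 0. *)

(* 1*3*...*(2k-1) / (2*4*...*(2k)), equal to 1 for k = 0 *)
Fixpoint odd_even_ratio (k : nat) : R :=
  match k with
  | O => 1
  | S k' => odd_even_ratio k' * (INR (2 * k - 1) / INR (2 * k))
  end.

Definition landau (n : nat) : R :=
  sum_n_m (fun k : nat => odd_even_ratio k ^ 2) 0 n.

(* [Lim_seq] takes values in the extended reals; this sequence converges. *)
Definition euler_gamma : R :=
  real (Lim_seq (fun n : nat => sum_n_m (fun k : nat => / INR k) 1 n - ln (INR n))).

(* The coefficients are meaningful for j = 0, s >= 2 and for j >= 1,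
   s >= j + 1 only; on these ranges no natural-number subtraction below
   truncates.  The values at other arguments are never used. *)
Definition d (j s : nat) : R :=
  match j with
  | O => (/ INR s - / INR (2 * s - 1)) + / (16 * INR (s - 1))
  | S _ =>
      if s =? j + 1 then 4 * INR j ^ 2
      else
        INR (2 * s + 2 * j - 2) * INR (fact (2 * s - 2))
          / (INR (fact (2 * s - 2 * j)) * INR (fact (2 * j - 1)))
        + INR (fact (2 * s - 3))
          / (8 * INR (fact (2 * s - 2 * j - 2)) * INR (fact (2 * j - 1)))
  end.

(* Course-of-values recursion: [beta_table k i] is the i-th coefficient for
   1 <= i <= k, and 0 for other i. *)
Fixpoint beta_table (k : nat) : nat -> R :=
  match k with
  | O => fun _ => 0
  | S k' => fun i =>
      if i =? k then
        -1 / (4 * INR k ^ 2)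
          * (sum_n_m (fun j : nat => d j (k + 1) * beta_table k' j) 1 (k - 1)
             - d 0 (k + 1))
      else beta_table k' i
  end.

(* Indexed by half the subscript: [beta k] is the number written beta_{2k}. *)
Definition beta (k : nat) : R := beta_table k k.

Lemma beta_table_beta (k i : nat) : (1 <= i <= k)%nat -> beta_table k i = beta i.
Proof.
induction k as [|k IH]; intros Hi; [lia|].
destruct (Nat.eq_dec i (S k)) as [->|Hne]; [reflexivity|].
cbn [beta_table].
destruct (Nat.eqb_spec i (S k)) as [He|_]; [contradiction|].
apply IH; lia.
Qed.

Lemma beta_rec (k : nat) : (1 <= k)%nat ->
  beta k = -1 / (4 * INR k ^ 2)
    * (sum_n_m (fun j : nat => d j (k + 1) * beta j) 1 (k - 1) - d 0 (k + 1)).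
Proof.
destruct k as [|k]; intros Hk; [lia|].
unfold beta at 1; cbn [beta_table]; rewrite Nat.eqb_refl.
do 2 f_equal; apply sum_n_m_ext_loc; intros j Hj.
rewrite beta_table_beta; [reflexivity|lia].
Qed.

(* The error term at N = n + 3/4. *)
Definition epsilon (l n : nat) : R :=
  let N := INR n + 3 / 4 in
  PI * landau n
  - (ln N + euler_gamma + 4 * ln 2
     + sum_n_m (fun s : nat => beta s / N ^ (2 * s)) 1 (l - 1)).

(* Main.v *)
Require Import Defs.
From Stdlib Require Import Reals Lra Lia Arith FunctionalExtensionality.
From Coquelicot Require Import Coquelicot.
Open Scope R_scope.

(** Write N = n + 3/4.  Formally,
      PI * G_n = const - reg. integral over u > 0 of exp(-N u) g(u),
      g(u) = h(u) / (2 sinh (u/2)),   h(u) = P_(-1/2) (cosh (u/2)),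
    with P_(-1/2) the Legendre function, so that ln N comes from the pole 1/u
    of g and beta_(2s) is -(2s-1)! times the coefficient of u^(2s-1) in g.
    Call a function enveloped by a power series with alternating signs when
    each remainder has the sign of the first omitted term.  Products of
    enveloped functions are enveloped ([trunc_mul_sign]), and a sign that holds
    for all u > 0 survives the Laplace transform ([laplace_pos]); hence it
    would be enough that h and 1 / sinh are enveloped.  The proof
    follows this idea, but transforms only products of polynomials with
    exp (u/2) and exp (-u/2), so that no integral representation of G_n is
    needed.

    (1) Let c be the series of ((u/2) coth (u/2) - 1) / u^2.  The Riccati
    equation of coth gives a recursion showing that c alternates, and, by
    induction on the order, that it envelops ([coth_quot_envelops]).  The
    series of h and of (u/2) / sinh (u/2) solve linear equations whose only
    non-polynomial coefficient is c, so they alternate as well, and what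
    remains when their truncations are put into these equations has a known
    sign ([leg_op_sign], [csch_trunc_sign]).

    (2) The steps D_n = PI (G_n - G_(n-1)) satisfy a first-order recurrence in
    n.  By (1), the Laplace transform of a truncation of h satisfies it up to
    an error of known sign; dividing by D_n gives a monotone sequence with
    limit 1, and so D_n is enveloped in powers of 1/M, M = n + 1/4
    ([landau_step_envelope]).  In the same way each power of 1/M is
    enveloped by central differences of ln and of even powers of 1/N
    ([midpoint_sign]).

    (3) Composing the two expansions, the difference of epsilon between n and
    n + 1 has a constant sign ([expansion_diff_sign]).  As epsilon tends to 0,
    it is monotone of constant sign.

    Two facts complete the argument.  The coefficients of g obey the
    recursion that defines beta ([beta_kernel]), because g solves the equation
    dual, under the Laplace transform, to the second-order difference equation
    of G_n.  And PI * G_n - ln N tends to gamma + 4 ln 2 ([landau_lim]): by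
    integration by parts, PI * G_n - (2 + 2/3 + ... + 2/(2n+1)) is twice the mean
    of ln (1 + sin t) for the weight sin^(2n+1) on [0, PI/2], which
    concentrates at PI/2. *)

(** * Finite sums *)

Fixpoint sum_below (f : nat -> R) (n : nat) : R :=
  match n with O => 0 | S n' => sum_below f n' + f n' end.

Lemma sum_below_ext f g n :
  (forall i, (i < n)%nat -> f i = g i) -> sum_below f n = sum_below g n.
Proof.
induction n as [|n IH]; intros H; simpl; [reflexivity|].
rewrite IH, H; auto.
Qed.

Lemma sum_below_plus f g n :
  sum_below (fun i => f i + g i) n = sum_below f n + sum_below g n.
Proof. induction n as [|n IH]; simpl; [ring|rewrite IH; ring]. Qed.

Lemma sum_below_scal c f n :
  sum_below (fun i => c * f i) n = c * sum_below f n.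
Proof. induction n as [|n IH]; simpl; [ring|rewrite IH; ring]. Qed.

Lemma sum_below_shift f n :
  sum_below f (S n) = f O + sum_below (fun i => f (S i)) n.
Proof. induction n as [|n IH]; simpl in *; [ring|rewrite IH; ring]. Qed.

Lemma sum_below_rev f n :
  sum_below f n = sum_below (fun i => f (n - 1 - i)%nat) n.
Proof.
induction n as [|n IH]; [reflexivity|].
rewrite (sum_below_shift (fun i => f (S n - 1 - i)%nat)). simpl sum_below at 1.
rewrite IH, Rplus_comm. f_equal; [f_equal; lia|].
apply sum_below_ext; intros i Hi; f_equal; lia.
Qed.

Lemma sum_below_zero f n : (forall i, (i < n)%nat -> f i = 0) -> sum_below f n = 0.
Proof.
induction n as [|n IH]; intros H; simpl; [reflexivity|].
rewrite IH, H; auto; ring.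
Qed.

Lemma sum_below_ge0 f n :
  (forall i, (i < n)%nat -> 0 <= f i) -> 0 <= sum_below f n.
Proof.
induction n as [|n IH]; intros H; simpl; [lra|].
assert (0 <= f n) by auto. assert (0 <= sum_below f n) by auto. lra.
Qed.

Lemma sum_below_sum_n_m f n :
  sum_n_m f 1 n = sum_below (fun i => f (S i)) n.
Proof.
induction n as [|n IH]; [reflexivity|].
rewrite sum_n_Sm by lia. rewrite IH. reflexivity.
Qed.

(** * Formal power series *)

(** Even power series in u are written as series in X = u^2.  On them
    [theta] is u d/du, which multiplies the coefficient of u^(2n) by 2n. *)
Definition series := nat -> R.
Definition conv (a b : series) : series :=
  fun n => sum_below (fun i => a i * b (n - i)%nat) (S n).
Definition sadd (a b : series) : series := fun n => a n + b n.
Definition ssub (a b : series) : series := fun n => a n - b n.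
Definition sopp (a : series) : series := fun n => - a n.
Definition cst (c : R) : series := fun n => match n with O => c | S _ => 0 end.
Definition X : series := fun n => match n with 1%nat => 1 | _ => 0 end.
Definition theta (a : series) : series := fun n => 2 * INR n * a n.

(** Truncated sums against an arbitrary weight [q]: for powers it gives the
    truncation of a product, for [q s = c (n - s)] associativity, and for
    differences of [log_pow] the composition of two expansions. *)
Lemma sum_below_conv (a b q : series) m :
  sum_below (fun s => conv a b s * q s) m =
  sum_below (fun i => a i * sum_below (fun k => b k * q (i + k)%nat) (m - i)) m.
Proof.
induction m as [|m IH]; [reflexivity|].
cbn [sum_below]. rewrite IH. unfold conv at 1. cbn [sum_below].
rewrite Rmult_comm, Rmult_plus_distr_l, <- sum_below_scal, <- Rplus_assoc,
  <- sum_below_plus.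
f_equal.
- apply sum_below_ext; intros i Hi.
  replace (S m - i)%nat with (S (m - i)) by lia. cbn [sum_below].
  replace (i + (m - i))%nat with m by lia. ring.
- replace (S m - m)%nat with 1%nat by lia. cbn [sum_below].
  replace (m - m)%nat with 0%nat by lia. replace (m + 0)%nat with m by lia. ring.
Qed.

Lemma convC a b : conv a b = conv b a.
Proof.
apply functional_extensionality; intros n; unfold conv.
rewrite sum_below_rev. apply sum_below_ext; intros i Hi.
replace (S n - 1 - i)%nat with (n - i)%nat by lia.
replace (n - (n - i))%nat with i by lia. ring.
Qed.

Lemma convA a b c : conv a (conv b c) = conv (conv a b) c.
Proof.
apply functional_extensionality; intros n. symmetry.
unfold conv at 1. rewrite (sum_below_conv a b (fun s => c (n - s)%nat)).
unfold conv. apply sum_below_ext; intros i Hi. f_equal.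
replace (S n - i)%nat with (S (n - i)) by lia.
apply sum_below_ext; intros k Hk. do 2 f_equal. lia.
Qed.

Lemma conv_cst c a n : conv (cst c) a n = c * a n.
Proof.
unfold conv. rewrite sum_below_shift, sum_below_zero.
- simpl. rewrite Nat.sub_0_r. ring.
- intros i _. simpl. ring.
Qed.

Lemma conv_X_S a n : conv X a (S n) = a n.
Proof.
unfold conv. rewrite !sum_below_shift, sum_below_zero.
- simpl. rewrite Nat.sub_0_r. ring.
- intros i _. simpl. ring.
Qed.

Lemma conv_X_0 a : conv X a O = 0.
Proof. unfold conv; simpl; ring. Qed.

Lemma conv_addl a b c : conv (sadd a b) c = sadd (conv a c) (conv b c).
Proof.
apply functional_extensionality; intros n; unfold conv, sadd.
rewrite <- sum_below_plus. apply sum_below_ext; intros; ring.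
Qed.

Lemma series_ring :
  ring_theory (cst 0) (cst 1) sadd conv ssub sopp (@eq series).
Proof.
split; intros; try (apply functional_extensionality; intros n; unfold sadd, ssub, sopp;
  try destruct n; simpl; ring).
- apply functional_extensionality; intros n. rewrite conv_cst; ring.
- apply convC.
- apply convA.
- apply conv_addl.
Qed.
Add Ring series_ring : series_ring.

Declare Scope series_scope.
Delimit Scope series_scope with S.
Bind Scope series_scope with series.
Infix "+" := sadd : series_scope.
Infix "*" := conv : series_scope.
Infix "-" := ssub : series_scope.
Notation "- a" := (sopp a) : series_scope.

Lemma sopp_cst a : (- a)%S = (cst (-1) * a)%S.
Proof. apply functional_extensionality; intros n. rewrite conv_cst. unfold sopp. ring. Qed.

Lemma theta_add a b : theta (a + b)%S = (theta a + theta b)%S.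
Proof. apply functional_extensionality; intros n; unfold theta, sadd; ring. Qed.

Lemma theta_sub a b : theta (a - b)%S = (theta a - theta b)%S.
Proof. apply functional_extensionality; intros n; unfold theta, ssub; ring. Qed.

Lemma theta_cst c : theta (cst c) = cst 0.
Proof. apply functional_extensionality; intros [|n]; unfold theta; simpl; ring. Qed.

Lemma theta_X : theta X = (X + X)%S.
Proof.
apply functional_extensionality; intros [|[|n]]; unfold theta, sadd; simpl; ring.
Qed.

Lemma theta_conv a b : theta (a * b)%S = (theta a * b + a * theta b)%S.
Proof.
apply functional_extensionality; intros n; unfold theta, conv, sadd.
rewrite <- sum_below_plus, <- sum_below_scal.
apply sum_below_ext; intros i Hi.
rewrite (minus_INR n i) by lia. ring.
Qed.

(** With the Leibniz rule, this proves identities between solutions of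
    differential equations. *)
Lemma theta_eq0 a : theta a = cst 0 -> a = cst (a O).
Proof.
intros H. apply functional_extensionality; intros [|n]; [reflexivity|].
assert (E : theta a (S n) = 0) by (rewrite H; reflexivity).
unfold theta in E. assert (0 < INR (S n)) by (apply lt_0_INR; lia). simpl cst. nra.
Qed.

(** Course-of-values recursion: [F a n] may read [a] only below [n], as in
    the hypothesis of [causal_fix_eq]. *)
Fixpoint table (F : series -> nat -> R) (n : nat) : series :=
  match n with
  | O => fun _ => 0
  | S n' => fun i => if (i =? n')%nat then F (table F n') n' else table F n' i
  end.
Definition causal_fix F : series := fun n => table F (S n) n.

Lemma causal_fix_table F n i : (i < n)%nat -> table F n i = causal_fix F i.
Proof.
induction n as [|n IH]; intros H; [lia|].
destruct (Nat.eq_dec i n) as [->|Hne]; [reflexivity|].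
simpl. destruct (Nat.eqb_spec i n) as [He|_]; [contradiction|]. apply IH; lia.
Qed.

Lemma causal_fix_eq F n :
  (forall a b, (forall i, (i < n)%nat -> a i = b i) -> F a n = F b n) ->
  causal_fix F n = F (causal_fix F) n.
Proof.
intros H. unfold causal_fix at 1. simpl. rewrite Nat.eqb_refl.
apply H. intros i Hi. apply causal_fix_table; exact Hi.
Qed.

Lemma conv_ext_le a b a' b' n :
  (forall i, (i <= n)%nat -> a i = a' i) -> (forall i, (i <= n)%nat -> b i = b' i) ->
  conv a b n = conv a' b' n.
Proof.
intros Ha Hb. unfold conv. apply sum_below_ext; intros i Hi.
rewrite Ha, Hb by lia. reflexivity.
Qed.

(** * The series of coth, 1/sinh and the Legendre function *)

(** The series of ((u/2) coth (u/2) - 1) / u^2, through the Riccati equation. *)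
Definition coth_ser : series := causal_fix (fun a n =>
  (cst (1/4) n - (X * (a * a))%S n) / (2 * INR n + 3)).
(** The solution of y' = u c(u) y with y(0) = 1.  As 1 + u^2 coth_ser is the
    logarithmic derivative of sinh (u/2), times u, it gives both
    (2/u) sinh (u/2) and its inverse. *)
Definition exp_ser (c : series) : series := causal_fix (fun a n =>
  match n with O => 1 | _ => (X * (c * a))%S n / (2 * INR n) end).
Definition csch_ser : series := exp_ser (- coth_ser)%S.
Definition sinh_ser : series := exp_ser coth_ser.
(** The series of h(u) = P_(-1/2) (cosh (u/2)), the even solution of
    h'' + (1/2) coth (u/2) h' + h/16 = 0; the equation is multiplied by u^2. *)
Definition leg_ser : series := causal_fix (fun a n =>
  match n with O => 1
  | _ => - (X * (coth_ser * theta a) + cst (1/16) * (X * a))%S n / (2 * INR n) ^ 2 end).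

Lemma conv_X_ext_lt a b n : (forall i, (i < n)%nat -> a i = b i) -> 
  (X * a)%S n = (X * b)%S n.
Proof.
destruct n as [|n]; intros H; [rewrite !conv_X_0; reflexivity|].
rewrite !conv_X_S. apply H; lia.
Qed.

Lemma coth_ser_eq :
  (theta coth_ser + cst 3 * coth_ser + X * (coth_ser * coth_ser))%S = cst (1/4).
Proof.
apply functional_extensionality; intros n. unfold sadd, theta. rewrite conv_cst.
assert (0 <= INR n) by apply pos_INR.
replace (coth_ser n) with ((cst (1/4) n - (X * (coth_ser * coth_ser))%S n) / (2 * INR n + 3)).
- field. lra.
- symmetry. unfold coth_ser at 1. apply (causal_fix_eq (fun a n =>
  (cst (1/4) n - (X * (a * a))%S n) / (2 * INR n + 3))).
  intros a b Hab. do 2 f_equal. apply conv_X_ext_lt. intros i Hi.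
  apply conv_ext_le; intros; apply Hab; lia.
Qed.

Lemma exp_ser_0 c : exp_ser c O = 1.
Proof. reflexivity. Qed.

Lemma exp_ser_eq c : theta (exp_ser c) = (X * (c * exp_ser c))%S.
Proof.
apply functional_extensionality; intros [|n].
- rewrite conv_X_0. unfold theta. simpl. ring.
- assert (0 < INR (S n)) by (apply lt_0_INR; lia). unfold theta.
  replace (exp_ser c (S n)) with ((X * (c * exp_ser c))%S (S n) / (2 * INR (S n))).
  + field. lra.
  + symmetry. unfold exp_ser at 1. rewrite causal_fix_eq; [reflexivity|].
    intros a b Hab. f_equal. apply conv_X_ext_lt. intros i Hi.
    apply conv_ext_le; [reflexivity|]; intros; apply Hab; lia.
Qed.

Lemma leg_ser_0 : leg_ser O = 1.
Proof. reflexivity. Qed.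

Lemma leg_ser_eq :
  (theta (theta leg_ser) + X * (coth_ser * theta leg_ser) + cst (1/16) * (X * leg_ser))%S = cst 0.
Proof.
apply functional_extensionality; intros [|n].
- unfold sadd. rewrite conv_cst, !conv_X_0. unfold theta. simpl. ring.
- assert (0 < INR (S n)) by (apply lt_0_INR; lia).
  assert (E : leg_ser (S n) = - (X * (coth_ser * theta leg_ser) + cst (1/16) * (X * leg_ser))%S (S n)
     / (2 * INR (S n)) ^ 2).
  { unfold leg_ser at 1. rewrite causal_fix_eq; [reflexivity|].
    intros a b Hab. f_equal. f_equal. unfold sadd. rewrite !conv_cst.
    f_equal; [|f_equal; apply conv_X_ext_lt; auto].
    apply conv_X_ext_lt. intros i Hi.
    apply conv_ext_le; [reflexivity|]. intros j Hj. unfold theta. rewrite Hab; [reflexivity|lia]. }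
  unfold sadd in *. simpl cst at 2.
  set (t := (X * (coth_ser * theta leg_ser))%S (S n) + (cst (1 / 16) * (X * leg_ser))%S (S n)) in *.
  rewrite Rplus_assoc. fold t. unfold theta. rewrite E. field. lra.
Qed.

Lemma csch_sinh : (csch_ser * sinh_ser)%S = cst 1.
Proof.
assert (H : theta (csch_ser * sinh_ser)%S = cst 0).
{ rewrite theta_conv. unfold csch_ser, sinh_ser. rewrite !exp_ser_eq. ring. }
rewrite (theta_eq0 _ H). f_equal.
unfold conv. simpl. unfold csch_ser, sinh_ser. rewrite !exp_ser_0. ring.
Qed.

(** u g(u), where g = h / (2 sinh (u/2)). *)
Definition kernel_ser : series := (leg_ser * csch_ser)%S.

Lemma kernel_ser_0 : kernel_ser O = 1.
Proof. unfold kernel_ser, conv, csch_ser. simpl. rewrite exp_ser_0, leg_ser_0. ring. Qed.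

Definition cosh_ser := (sinh_ser + theta sinh_ser)%S.

(** sinh and cosh enter only through the solution of theta y = X coth_ser y;
    this is where that solution is recognised: the derivative of cosh is sinh. *)
Lemma theta_cosh : theta cosh_ser = (cst (1/4) * (X * sinh_ser))%S.
Proof.
unfold cosh_ser. rewrite theta_add.
assert (Hs : theta sinh_ser = (X * (coth_ser * sinh_ser))%S) by apply exp_ser_eq.
rewrite Hs, !theta_conv, theta_X, Hs, <- coth_ser_eq.
replace (cst 3) with (cst 1 + cst 1 + cst 1)%S. ring.
apply functional_extensionality; intros [|n]; unfold sadd; simpl; ring.
Qed.

Lemma cosh_sinh_sq :
  (cosh_ser * cosh_ser - cst (1/4) * (X * (sinh_ser * sinh_ser)))%S = cst 1.
Proof.
assert (H : theta (cosh_ser * cosh_ser - cst (1/4) * (X * (sinh_ser * sinh_ser)))%S = cst 0).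
{ rewrite theta_sub, !theta_conv, theta_cosh, theta_X, theta_cst.
  replace (theta sinh_ser) with (cosh_ser - sinh_ser)%S by (unfold cosh_ser; ring). ring. }
rewrite (theta_eq0 _ H). f_equal.
unfold ssub. rewrite conv_cst, conv_X_0. unfold conv, cosh_ser, sadd, theta. simpl.
unfold sinh_ser. rewrite !exp_ser_0. ring.
Qed.

(** 4 sinh^2 (u/2) / u^2 = 2 (cosh u - 1) / u^2 and sinh u / u. *)
Definition sinh_sq : series := (sinh_ser * sinh_ser)%S.
Definition sinh_dbl : series := (sinh_ser * cosh_ser)%S.

(** The duplication formulas, read off from the first-order system
    theta P + 2P = 2Q, theta Q + Q = 1 + X P / 2 instead of binomial sums. *)
Lemma sinh_coef m :
  sinh_sq m = 2 / INR (fact (2 * m + 2)) /\ sinh_dbl m = / INR (fact (2 * m + 1)).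
Proof.
assert (HP : (theta sinh_sq + cst 2 * sinh_sq)%S = (cst 2 * sinh_dbl)%S).
{ unfold sinh_sq, sinh_dbl, cosh_ser. rewrite theta_conv.
  replace (cst 2) with (cst 1 + cst 1)%S. ring.
  apply functional_extensionality; intros [|n]; unfold sadd; simpl; ring. }
assert (HQ : (theta sinh_dbl + sinh_dbl)%S = (cst 1 + cst (1/2) * (X * sinh_sq))%S).
{ rewrite <- cosh_sinh_sq. unfold sinh_sq, sinh_dbl. rewrite theta_conv, theta_cosh.
  replace (theta sinh_ser) with (cosh_ser - sinh_ser)%S by (unfold cosh_ser; ring).
  replace (cst (1/2)) with (cst (1/4) + cst (1/4))%S. ring.
  apply functional_extensionality; intros [|n]; unfold sadd; simpl; field. }
assert (step : forall k, sinh_dbl k = / INR (fact (2 * k + 1)) ->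
  sinh_sq k = 2 / INR (fact (2 * k + 2))).
{ intros k Hk. apply (f_equal (fun a => a k)) in HP. unfold sadd in HP.
  rewrite !conv_cst, Hk in HP. unfold theta in HP.
  replace (2 * k + 2)%nat with (S (2 * k + 1)) by lia.
  rewrite fact_simpl, mult_INR, S_INR, plus_INR, mult_INR.
  change (INR 2) with 2; change (INR 1) with 1.
  assert (0 < INR (fact (2 * k + 1))) by apply INR_fact_lt_0.
  assert (0 <= INR k) by apply pos_INR.
  apply (Rmult_eq_reg_l (2 * INR k + 2)); [|lra].
  replace ((2 * INR k + 2) * sinh_sq k) with (2 * INR k * sinh_sq k + 2 * sinh_sq k) by ring.
  rewrite HP. field. lra. }
induction m as [|m [IHP IHQ]].
- assert (H0 : sinh_dbl O = / INR (fact (2 * 0 + 1))).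
  { apply (f_equal (fun a => a O)) in HQ. unfold sadd in HQ.
    rewrite conv_cst, conv_X_0 in HQ. unfold theta in HQ. simpl in *. lra. }
  split; [apply step|]; exact H0.
- assert (H0 : sinh_dbl (S m) = / INR (fact (2 * S m + 1))).
  { apply (f_equal (fun a => a (S m))) in HQ. unfold sadd in HQ.
    rewrite conv_cst, conv_X_S, IHP in HQ. unfold theta in HQ. simpl cst in HQ.
    replace (2 * S m + 1)%nat with (S (2 * m + 2)) by lia.
    rewrite fact_simpl, mult_INR, (S_INR (2 * m + 2)), plus_INR, mult_INR.
    change (INR 2) with 2.
    rewrite S_INR in HQ.
    assert (0 < INR (fact (2 * m + 2))) by apply INR_fact_lt_0.
    assert (0 <= INR m) by apply pos_INR.
    apply (Rmult_eq_reg_l (2 * INR m + 3)); [|lra].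
    replace ((2 * INR m + 3) * sinh_dbl (S m)) with (2 * (INR m + 1) * sinh_dbl (S m) + sinh_dbl (S m)) by ring.
    rewrite HQ. field. lra. }
  split; [apply step|]; exact H0.
Qed.

(** The second-order difference operator that annihilates G_n,
      (N^2 + 1/16) (w(N+1) - 2 w(N) + w(N-1)) + (N/2) (w(N+1) - w(N-1)),
    becomes y -> (4 sinh^2(u/2) y)'' - (sinh u y)' + sinh^2(u/2) y / 4
    under w(N) = integral of exp(-N u) y(u).  For y = g this equals
    2 sinh (u/2) times the Legendre equation for h = 2 sinh (u/2) g. *)
Lemma kernel_ser_eq :
  (theta (theta (sinh_sq * kernel_ser) + sinh_sq * kernel_ser) - theta (sinh_dbl * kernel_ser)
    + cst (1/16) * (X * (sinh_sq * kernel_ser)))%S = cst 0.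
Proof.
assert (Hc := csch_sinh).
assert (HP : (sinh_sq * kernel_ser)%S = (sinh_ser * leg_ser)%S).
{ unfold sinh_sq, kernel_ser.
  transitivity (sinh_ser * leg_ser * (csch_ser * sinh_ser))%S; [ring|rewrite Hc; ring]. }
assert (HQ : (sinh_dbl * kernel_ser)%S = (cosh_ser * leg_ser)%S).
{ unfold sinh_dbl, kernel_ser.
  transitivity (cosh_ser * leg_ser * (csch_ser * sinh_ser))%S; [ring|rewrite Hc; ring]. }
rewrite HP, HQ.
transitivity (sinh_ser * (theta (theta leg_ser) + X * (coth_ser * theta leg_ser) 
   + cst (1/16) * (X * leg_ser)))%S; [|rewrite leg_ser_eq; ring].
unfold cosh_ser.
assert (Hs : theta sinh_ser = (X * (coth_ser * sinh_ser))%S) by apply exp_ser_eq.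
rewrite !theta_conv, !theta_add, !theta_conv. rewrite Hs. ring.
Qed.

(** * The recursion of the coefficients beta *)

(** Coefficient of u^(2k) in [kernel_ser_eq] coming from u^(2j) in
    [kernel_ser]; up to factorials this is d_(j,k+1). *)
Definition rec_coef (k j : nat) : R :=
  2 * INR k * (2 * INR k + 1) * sinh_sq (k - j)%nat - 2 * INR k * sinh_dbl (k - j)%nat
  + / 16 * (X * sinh_sq)%S (k - j)%nat.

Lemma kernel_ser_rec k : sum_below (fun j => kernel_ser j * rec_coef k j) (S k) = 0.
Proof.
assert (H := f_equal (fun a => a k) kernel_ser_eq).
unfold sadd, ssub, theta in H. rewrite conv_cst in H.
replace (X * (sinh_sq * kernel_ser))%S with (kernel_ser * (X * sinh_sq))%S in H by ring.
rewrite (convC sinh_sq), (convC sinh_dbl) in H.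
replace (cst 0 k) with 0 in H by (destruct k; reflexivity).
rewrite <- H.
transitivity (2 * INR k * (2 * INR k + 1) * conv kernel_ser sinh_sq k
  + (- (2 * INR k)) * conv kernel_ser sinh_dbl k + / 16 * conv kernel_ser (X * sinh_sq)%S k).
- unfold conv at 1 2 3. rewrite <- !sum_below_scal, <- !sum_below_plus.
  apply sum_below_ext; intros i Hi. unfold rec_coef. ring.
- field.
Qed.

Lemma d_rec_coef j k : (1 <= j <= k)%nat ->
  d j (k + 1) * INR (fact (2 * j - 1)) = INR (fact (2 * k - 1)) * rec_coef k j.
Proof.
intros [Hj Hk]. unfold d. destruct j as [|j']; [lia|]. set (j := S j') in *.
assert (Fj := INR_fact_lt_0 (2 * j - 1)).
assert (E2 : INR (fact (2 * k)) = 2 * INR k * INR (fact (2 * k - 1))).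
{ replace (2 * k)%nat with (S (2 * k - 1)) at 1 by lia.
  rewrite fact_simpl, mult_INR. replace (S (2 * k - 1)) with (2 * k)%nat by lia.
  rewrite mult_INR. reflexivity. }
unfold rec_coef.
destruct (sinh_coef (k - j)) as [-> ->].
destruct (Nat.eqb_spec (k + 1) (j + 1)) as [He|Hne].
- assert (k = j) by lia. subst k. rewrite Nat.sub_diag, conv_X_0.
  change (INR (fact (2 * 0 + 2))) with 2. change (INR (fact (2 * 0 + 1))) with 1. field.
- assert (Hm : exists m, k = (j + S m)%nat) by (exists (k - j - 1)%nat; lia).
  destruct Hm as [m ->].
  replace (j + S m - j)%nat with (S m) by lia. rewrite conv_X_S.
  destruct (sinh_coef m) as [-> _].
  set (k := (j + S m)%nat) in *.
  replace (2 * (k + 1) + 2 * j - 2)%nat with (2 * (k + j))%nat by lia.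
  replace (2 * (k + 1) - 2)%nat with (2 * k)%nat by lia.
  replace (2 * (k + 1) - 3)%nat with (2 * k - 1)%nat by lia.
  replace (2 * (k + 1) - 2 * j)%nat with (S (S (2 * m + 2))) by lia.
  replace (2 * (k + 1) - 2 * j - 2)%nat with (2 * m + 2)%nat by lia.
  replace (S (S (2 * m + 2)) - 2)%nat with (2 * m + 2)%nat by lia.
  replace (2 * S m + 2)%nat with (S (S (2 * m + 2))) by lia.
  replace (2 * S m + 1)%nat with (S (2 * m + 2)) by lia.
  rewrite E2.
  rewrite (fact_simpl (S (2 * m + 2))), (fact_simpl (2 * m + 2)), !mult_INR.
  assert (Fm := INR_fact_lt_0 (2 * m + 2)). 
  assert (Hk' : INR k = INR j + INR m + 1) by (unfold k; rewrite plus_INR, S_INR; ring).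
  change (INR 2) with 2.
  rewrite (plus_INR k j), !S_INR, (plus_INR (2 * m)), mult_INR, Hk'.
  change (INR 2) with 2.
  assert (0 <= INR m) by apply pos_INR.
  assert (0 <= INR j) by apply pos_INR.
  field. repeat split; lra.
Qed.

Lemma d0_rec_coef k : (1 <= k)%nat -> d 0 (k + 1) = INR (fact (2 * k - 1)) * rec_coef k 0.
Proof.
intros Hk. unfold d, rec_coef. rewrite Nat.sub_0_r.
destruct k as [|m]; [lia|]. rewrite conv_X_S.
destruct (sinh_coef (S m)) as [-> ->]. destruct (sinh_coef m) as [-> _].
replace (2 * (S m + 1) - 1)%nat with (2 * m + 3)%nat by lia.
replace (S m + 1 - 1)%nat with (S m) by lia.
replace (2 * S m - 1)%nat with (2 * m + 1)%nat by lia.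
replace (2 * S m + 2)%nat with (S (S (S (2 * m + 1)))) by lia.
replace (2 * S m + 1)%nat with (S (S (2 * m + 1))) by lia.
replace (2 * m + 2)%nat with (S (2 * m + 1)) by lia.
rewrite (fact_simpl (S (S (2 * m + 1)))), (fact_simpl (S (2 * m + 1))), (fact_simpl (2 * m + 1)), !mult_INR.
assert (Fm := INR_fact_lt_0 (2 * m + 1)).
rewrite !plus_INR.
change (INR 3) with (2 + 1). change (INR 1) with 1.
rewrite !S_INR, plus_INR, mult_INR.
change (INR 2) with 2. change (INR 1) with 1.
assert (0 <= INR m) by apply pos_INR.
field. repeat split; lra.
Qed.

Lemma beta_kernel s : (1 <= s)%nat -> beta s = - INR (fact (2 * s - 1)) * kernel_ser s.
Proof.
induction s as [s IH] using lt_wf_ind. intros Hs.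
rewrite beta_rec by exact Hs.
rewrite sum_below_sum_n_m, d0_rec_coef by exact Hs.
assert (Hlam : kernel_ser O * rec_coef s 0 +
  (sum_below (fun i => kernel_ser (S i) * rec_coef s (S i)) (s - 1) + kernel_ser s * rec_coef s s) = 0).
{ rewrite <- (kernel_ser_rec s), sum_below_shift. f_equal.
  transitivity (sum_below (fun i => kernel_ser (S i) * rec_coef s (S i)) (S (s - 1))).
  - cbn [sum_below]. replace (S (s - 1)) with s by lia. reflexivity.
  - f_equal. lia. }
rewrite (sum_below_ext _ (fun i => - INR (fact (2 * s - 1)) * (kernel_ser (S i) * rec_coef s (S i)))).
2:{ intros i Hi. rewrite IH by lia.
  replace (d (S i) (s + 1) * (- INR (fact (2 * S i - 1)) * kernel_ser (S i)))
    with (- (d (S i) (s + 1) * INR (fact (2 * S i - 1))) * kernel_ser (S i)) by ring.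
  rewrite d_rec_coef by lia. ring. }
rewrite sum_below_scal.
set (t := sum_below _ _) in *.
rewrite kernel_ser_0 in Hlam.
assert (Hl : rec_coef s s = 4 * INR s ^ 2).
{ unfold rec_coef. rewrite Nat.sub_diag, conv_X_0. destruct (sinh_coef 0) as [-> ->].
  simpl. field. }
rewrite Hl in Hlam.
assert (0 < INR s) by (apply lt_0_INR; lia).
replace t with (- (rec_coef s 0 + kernel_ser s * (4 * INR s ^ 2))) by lra.
field. lra.
Qed.

(** * Alternating signs *)

Definition alternating (a : series) := forall n, 0 < (-1) ^ n * a n.
Definition weakly_alternating (a : series) := forall n, 0 <= (-1) ^ n * a n.

Lemma pow_m1_split i n : (i <= n)%nat -> (-1) ^ n = (-1) ^ i * (-1) ^ (n - i).
Proof. intros H. rewrite <- pow_add. f_equal. lia. Qed.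

Lemma conv_term_sign (a b : series) i n : (i <= n)%nat ->
  (-1) ^ n * (a i * b (n - i)%nat) = (-1) ^ i * a i * ((-1) ^ (n - i) * b (n - i)%nat).
Proof. intros H. rewrite (pow_m1_split i n H). ring. Qed.

Lemma conv_sign a b n :
  (forall i, (i <= n)%nat -> 0 <= (-1) ^ i * a i) ->
  (forall i, (i <= n)%nat -> 0 <= (-1) ^ i * b i) -> 0 <= (-1) ^ n * conv a b n.
Proof.
intros Ha Hb. unfold conv. rewrite <- sum_below_scal. apply sum_below_ge0; intros i Hi.
rewrite conv_term_sign by lia. apply Rmult_le_pos; [apply Ha|apply Hb]; lia.
Qed.

Lemma conv_sign_lt a b n :
  (forall i, (i <= n)%nat -> 0 < (-1) ^ i * a i) ->
  (forall i, (i <= n)%nat -> 0 < (-1) ^ i * b i) -> 0 < (-1) ^ n * conv a b n.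
Proof.
intros Ha Hb.
assert (H : forall i, (i <= n)%nat -> 0 < (-1) ^ n * (a i * b (n - i)%nat)).
{ intros i Hi. rewrite conv_term_sign by lia.
  apply Rmult_lt_0_compat; [apply Ha|apply Hb]; lia. }
unfold conv. cbn [sum_below]. rewrite Rmult_plus_distr_l, <- sum_below_scal.
apply Rplus_le_lt_0_compat; [|apply H; lia].
apply sum_below_ge0; intros i Hi. apply Rlt_le, H. lia.
Qed.

(** In the Riccati recursion, every term of the convolution square has the
    same sign. *)
Lemma coth_alternating : alternating coth_ser.
Proof.
intros n. induction n as [n IH] using lt_wf_ind.
assert (H := f_equal (fun a => a n) coth_ser_eq).
unfold sadd in H. rewrite conv_cst in H. unfold theta in H.
assert (0 <= INR n) by apply pos_INR.
destruct n as [|n].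
- rewrite conv_X_0 in H. simpl in *. lra.
- rewrite conv_X_S in H. simpl cst in H.
  assert (Hc := conv_sign_lt coth_ser coth_ser n).
  assert (0 < (-1) ^ n * conv coth_ser coth_ser n) by (apply Hc; intros; apply IH; lia).
  assert (E : conv coth_ser coth_ser n = - (2 * INR (S n) + 3) * coth_ser (S n)) by lra.
  rewrite E in H1. simpl pow.
  apply (Rmult_lt_reg_l (2 * INR (S n) + 3)); [lra|]. rewrite Rmult_0_r. nra.
Qed.

Lemma csch_alternating : alternating csch_ser.
Proof.
intros n. induction n as [n IH] using lt_wf_ind.
assert (H := f_equal (fun a => a n) (exp_ser_eq (- coth_ser)%S)).
fold csch_ser in H. unfold theta in H.
destruct n as [|n]; [unfold csch_ser; rewrite exp_ser_0; simpl; lra|].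
rewrite conv_X_S in H.
replace (- coth_ser * csch_ser)%S with (cst (-1) * (coth_ser * csch_ser))%S in H
  by (rewrite (sopp_cst coth_ser); ring).
rewrite conv_cst in H.
assert (0 < (-1) ^ n * conv coth_ser csch_ser n).
{ apply conv_sign_lt; intros; [apply coth_alternating|apply IH; lia]. }
assert (0 < INR (S n)) by (apply lt_0_INR; lia).
assert (E : conv coth_ser csch_ser n = - (2 * INR (S n)) * csch_ser (S n)) by lra.
rewrite E in H0. simpl pow.
apply (Rmult_lt_reg_l (2 * INR (S n))); [lra|]. rewrite Rmult_0_r. nra.
Qed.

Lemma leg_alternating : alternating leg_ser.
Proof.
intros n. induction n as [n IH] using lt_wf_ind.
assert (H := f_equal (fun a => a n) leg_ser_eq).
unfold sadd in H. rewrite conv_cst in H.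
destruct n as [|n]; [rewrite leg_ser_0; simpl; lra|].
rewrite !conv_X_S in H. simpl cst in H.
assert (0 <= (-1) ^ n * conv coth_ser (theta leg_ser) n).
{ apply conv_sign; intros; [apply Rlt_le, coth_alternating|]. unfold theta.
  assert (0 <= INR i) by apply pos_INR. assert (0 < (-1) ^ i * leg_ser i) by (apply IH; lia). nra. }
assert (0 < (-1) ^ n * leg_ser n) by (apply IH; lia).
assert (0 < INR (S n)) by (apply lt_0_INR; lia).
unfold theta at 1 2 in H.
assert (E : conv coth_ser (theta leg_ser) n = - (2 * INR (S n)) ^ 2 * leg_ser (S n) - 1/16 * leg_ser n) by lra.
rewrite E in H0. simpl ((-1) ^ S n).
apply (Rmult_lt_reg_l ((2 * INR (S n)) ^ 2)); [nra|]. rewrite Rmult_0_r. nra.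
Qed.

(** * Enveloping series *)
Definition trunc (a : series) (m : nat) (x : R) := sum_below (fun i => a i * x ^ i) m.

Lemma trunc_conv a b m x :
  trunc (a * b)%S m x = sum_below (fun i => a i * x ^ i * trunc b (m - i) x) m.
Proof.
unfold trunc. rewrite (sum_below_conv a b (fun n => x ^ n)).
apply sum_below_ext; intros i Hi. rewrite Rmult_assoc. f_equal.
rewrite <- sum_below_scal. apply sum_below_ext; intros k Hk. rewrite pow_add. ring.
Qed.

Lemma trunc_mul a b p x G :
  trunc a p x * G - trunc (a * b)%S p x =
  sum_below (fun i => a i * x ^ i * (G - trunc b (p - i) x)) p.
Proof.
rewrite trunc_conv. unfold trunc at 1.
rewrite Rmult_comm, <- sum_below_scal.
replace (sum_below (fun i => a i * x ^ i * trunc b (p - i) x) p) with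
 (- sum_below (fun i => - 1 * (a i * x ^ i * trunc b (p - i) x)) p)
 by (rewrite sum_below_scal; ring).
unfold Rminus. rewrite Ropp_involutive, <- sum_below_plus.
apply sum_below_ext; intros; ring.
Qed.

(** F is a number, the value at the point x of the function considered, and m
    bounds the order of truncation: the inductions need both at hand. *)
Definition envelops (a : series) (m : nat) (x F : R) :=
  forall j, (j <= m)%nat -> 0 < (-1) ^ j * (F - trunc a j x).

(** Why products inherit enveloping: the remainder of a product splits into
    the terms of [a] times remainders of [b] ([trunc_mul]), and all these
    have the same sign. *)
Lemma trunc_mul_sign a b p x G : 0 < x -> weakly_alternating a -> envelops b p x G ->
  0 <= (-1) ^ p * (trunc a p x * G - trunc (a * b)%S p x).
Proof.
intros Hx Ha Hb. rewrite trunc_mul, <- sum_below_scal.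
apply sum_below_ge0; intros i Hi.
rewrite (pow_m1_split i p) by lia.
replace ((-1) ^ i * (-1) ^ (p - i) * (a i * x ^ i * (G - trunc b (p - i) x))) with
  ((-1) ^ i * a i * (x ^ i * ((-1) ^ (p - i) * (G - trunc b (p - i) x)))) by ring.
apply Rmult_le_pos; [apply Ha|]. apply Rmult_le_pos; [apply pow_le; lra|].
apply Rlt_le, Hb. lia.
Qed.

Lemma alternating_weakly a : alternating a -> weakly_alternating a.
Proof. intros H n. apply Rlt_le, H. Qed.

Lemma trunc_add a b m x : trunc (a + b)%S m x = trunc a m x + trunc b m x.
Proof.
unfold trunc. rewrite <- sum_below_plus. apply sum_below_ext; intros; unfold sadd; ring.
Qed.

Lemma trunc_cst_conv c a m x : trunc (cst c * a)%S m x = c * trunc a m x.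
Proof.
unfold trunc. rewrite <- sum_below_scal. apply sum_below_ext; intros.
rewrite conv_cst; ring.
Qed.

Lemma trunc_X a m x : trunc (X * a)%S (S m) x = x * trunc a m x.
Proof.
unfold trunc. rewrite sum_below_shift, conv_X_0, <- sum_below_scal, Rmult_0_l, Rplus_0_l.
apply sum_below_ext; intros. rewrite conv_X_S. simpl. ring.
Qed.

Lemma trunc_cst c m x : trunc (cst c) (S m) x = c.
Proof.
unfold trunc. rewrite sum_below_shift, sum_below_zero; [simpl; ring|].
intros; simpl; ring.
Qed.

Lemma is_derive_sum_below (f f' : nat -> R -> R) n u :
  (forall i, (i < n)%nat -> is_derive (f i) u (f' i u)) ->
  is_derive (fun v => sum_below (fun i => f i v) n) u (sum_below (fun i => f' i u) n).
Proof.
induction n as [|n IH]; intros H; simpl.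
- auto_derive; auto.
- apply (is_derive_plus (fun v => sum_below (fun i => f i v) n) (f n)); auto.
Qed.

Lemma is_derive_trunc a m u : u <> 0 ->
  is_derive (fun v => trunc a m (v ^ 2)) u (trunc (theta a) m (u ^ 2) / u).
Proof.
intros Hu. unfold trunc.
replace (sum_below (fun i => theta a i * (u ^ 2) ^ i) m / u) with
  (sum_below (fun i => / u * (theta a i * (u ^ 2) ^ i)) m)
  by (rewrite sum_below_scal; field; exact Hu).
apply (is_derive_sum_below (fun i v => a i * (v ^ 2) ^ i) (fun i u => / u * (theta a i * (u ^ 2) ^ i))).
intros i Hi. auto_derive; [exact I|]. unfold theta.
destruct i as [|i]; [simpl; field; exact Hu|].
simpl pred. rewrite <- (tech_pow_Rmult (u ^ 2) i). change (u * (u * 1)) with (u ^ 2). field. exact Hu.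
Qed.

(** * Hyperbolic functions *)

Definition two_sinh (u : R) := exp (u / 2) - exp (- (u / 2)).
Definition cosh_half (u : R) := (exp (u / 2) + exp (- (u / 2))) / 2.
(** ((u/2) coth (u/2) - 1) / u^2 *)
Definition coth_quot (u : R) := (u * cosh_half u / two_sinh u - 1) / u ^ 2.

Lemma two_sinh_derive u : is_derive two_sinh u (cosh_half u).
Proof. unfold two_sinh, cosh_half. auto_derive; [exact I|]. unfold Rdiv. field. Qed.
Lemma cosh_half_derive u : is_derive cosh_half u (two_sinh u / 4).
Proof. unfold two_sinh, cosh_half. auto_derive; [exact I|]. unfold Rdiv. field. Qed.

Lemma cosh_half_sq u : cosh_half u ^ 2 = 1 + two_sinh u ^ 2 / 4.
Proof.
unfold two_sinh, cosh_half.
assert (H : exp (u / 2) * exp (- (u / 2)) = 1) by (rewrite <- exp_plus, Rplus_opp_r; apply exp_0).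
nra.
Qed.

Lemma two_sinh_pos u : 0 < u -> 0 < two_sinh u.
Proof. intros H. unfold two_sinh. assert (exp (- (u / 2)) < exp (u / 2)) by (apply exp_increasing; lra). lra. Qed.
Lemma cosh_half_pos u : 0 < cosh_half u.
Proof. unfold cosh_half. assert (H1 := exp_pos (u / 2)). assert (H2 := exp_pos (- (u / 2))). lra. Qed.
Lemma two_sinh_0 : two_sinh 0 = 0.
Proof. unfold two_sinh. replace (- (0 / 2)) with (0 / 2) by field. ring. Qed.

Lemma cosh_half_coth_quot u : 0 < u ->
  u * cosh_half u = two_sinh u * (1 + u ^ 2 * coth_quot u).
Proof.
intros Hu. assert (HA := two_sinh_pos u Hu). unfold coth_quot. field. split; lra.
Qed.

Lemma incr_pos (f f' : R -> R) (u : R) : 0 < u ->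
  (forall v, 0 <= v -> is_derive f v (f' v)) ->
  (forall v, 0 < v -> 0 < f' v) -> f 0 < f u.
Proof.
intros Hu Hd Hp.
destruct (MVT_cor2 f f' 0 u Hu) as [c [Hc1 Hc2]].
{ intros c Hc. apply is_derive_Reals, Hd. lra. }
assert (0 < f' c) by (apply Hp; lra). nra.
Qed.

(** 1 < v coth v < 1 + v for v = u/2: crude, but enough to control
    [coth_quot] at 0. *)
Lemma coth_bounds u : 0 < u -> two_sinh u < u * cosh_half u < two_sinh u * (1 + u / 2).
Proof.
intros Hu. split.
- assert (H := incr_pos (fun v => v * cosh_half v - two_sinh v) (fun v => v * (two_sinh v / 4)) u Hu).
  simpl in H. rewrite two_sinh_0 in H.
  assert (0 * cosh_half 0 - 0 < u * cosh_half u - two_sinh u); [|lra].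
  apply H.
  + intros v _. auto_derive.
    * split; [eexists; apply cosh_half_derive|split; [eexists; apply two_sinh_derive|exact I]].
    * replace (Derive (fun x => cosh_half x) v) with (two_sinh v / 4) by (symmetry; apply is_derive_unique, cosh_half_derive).
      replace (Derive (fun x => two_sinh x) v) with (cosh_half v) by (symmetry; apply is_derive_unique, two_sinh_derive).
      ring.
  + intros v Hv. assert (HA := two_sinh_pos v Hv). nra.
- assert (H : 1 + u < exp u) by (apply exp_ineq1; lra).
  assert (He : exp u = exp (u / 2) * exp (u / 2)) by (rewrite <- exp_plus; f_equal; field).
  assert (Hm : exp (u / 2) * exp (- (u / 2)) = 1) by (rewrite <- exp_plus, Rplus_opp_r; apply exp_0).
  assert (Hp := exp_pos (- (u / 2))).
  unfold two_sinh, cosh_half.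
  assert (1 - exp (- (u / 2)) * exp (- (u / 2)) * (1 + u) > 0).
  { assert (exp (- (u / 2)) * exp (- (u / 2)) * (1 + u) < exp (- (u / 2)) * exp (- (u / 2)) * exp u) 
      by (apply Rmult_lt_compat_l; nra).
    rewrite He in H0. nra. }
  assert (exp (u / 2) - exp (- (u / 2)) * (1 + u) > 0).
  { replace (exp (u / 2) - exp (- (u / 2)) * (1 + u)) with
    (exp (u / 2) * (1 - exp (- (u / 2)) * exp (- (u / 2)) * (1 + u))).
    - apply Rmult_gt_0_compat; [apply exp_pos|exact H0].
    - ring_simplify. replace (exp (u / 2) * exp (- (u / 2)) ^ 2) with
       (exp (u / 2) * exp (- (u / 2)) * exp (- (u / 2))) by ring. 
      rewrite Hm. nra. }
  nra.
Qed.

Lemma coth_quot_bounds u : 0 < u -> 0 < coth_quot u < / (2 * u).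
Proof.
intros Hu. assert (HA := two_sinh_pos u Hu). destruct (coth_bounds u Hu) as [H1 H2].
unfold coth_quot. assert (0 < / two_sinh u) by (apply Rinv_0_lt_compat; lra).
assert (Hl : 1 < u * cosh_half u / two_sinh u).
{ apply (Rmult_lt_reg_r (two_sinh u)); [lra|]. field_simplify; lra. }
assert (Hr : u * cosh_half u / two_sinh u < 1 + u / 2).
{ apply (Rmult_lt_reg_r (two_sinh u)); [lra|]. field_simplify; lra. }
assert (0 < u ^ 2) by nra.
split.
- apply Rdiv_lt_0_compat; lra.
- apply (Rmult_lt_reg_r (u ^ 2)); [lra|]. field_simplify; [|lra|lra].
  apply (Rmult_lt_reg_r (2 * two_sinh u)); [lra|]. field_simplify; nra.
Qed.

Lemma coth_quot_derive u : 0 < u ->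
  is_derive coth_quot u ((1 / 4 - 3 * coth_quot u - u ^ 2 * coth_quot u ^ 2) / u).
Proof.
intros Hu. assert (HA := two_sinh_pos u Hu). unfold coth_quot at 1.
auto_derive.
- repeat split; try (eexists; apply cosh_half_derive); try (eexists; apply two_sinh_derive); try lra; nra.
- replace (Derive (fun x => cosh_half x) u) with (two_sinh u / 4) by (symmetry; apply is_derive_unique, cosh_half_derive).
  replace (Derive (fun x => two_sinh x) u) with (cosh_half u) by (symmetry; apply is_derive_unique, two_sinh_derive).
  assert (Hsq := cosh_half_sq u). unfold coth_quot. 
  field_simplify_eq; [|lra]. rewrite ?Hsq. field_simplify_eq. ring [Hsq].
Qed.

Lemma trunc_bounded a m : exists K, 0 < K /\ forall x, 0 <= x <= 1 -> Rabs (trunc a m x) <= K.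
Proof.
induction m as [|m [K [HK IH]]].
- exists 1. split; [lra|]. intros x _. unfold trunc; simpl. rewrite Rabs_R0. lra.
- exists (K + Rabs (a m)). split; [assert (H := Rabs_pos (a m)); lra|].
  intros x Hx. unfold trunc; simpl. fold (trunc a m x).
  eapply Rle_trans; [apply Rabs_triang|]. apply Rplus_le_compat; [apply IH; exact Hx|].
  rewrite Rabs_mult. rewrite <- (Rmult_1_r (Rabs (a m))) at 2.
  apply Rmult_le_compat_l; [apply Rabs_pos|].
  rewrite <- RPow_abs, (Rabs_pos_eq x) by lra.
  rewrite <- (pow1 m). apply pow_incr. exact Hx.
Qed.

(** Functions such as [coth_quot] are not defined at 0; the lower bound
    replaces the value 0 there. *)
Lemma pos_of_incr (g g' : R -> R) K : 0 < K ->
  (forall v, 0 < v -> is_derive g v (g' v)) -> (forall v, 0 < v -> 0 < g' v) ->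
  (forall v, 0 < v <= 1 -> - (K * v) <= g v) -> forall u, 0 < u -> 0 < g u.
Proof.
intros HK Hd Hp Hb.
assert (Hinc : forall v u, 0 < v < u -> g v < g u).
{ intros v u Hvu. destruct (MVT_cor2 g g' v u (proj2 Hvu)) as [c [Hc1 Hc2]].
  - intros c Hc. apply is_derive_Reals, Hd. lra.
  - assert (0 < g' c) by (apply Hp; lra). nra. }
intros u Hu. destruct (Rlt_le_dec 0 (g u)) as [H|H]; [exact H|exfalso].
assert (Hh : g (u / 2) < g u) by (apply Hinc; lra).
set (c := - g (u / 2)) in *. assert (Hc : 0 < c) by (unfold c; lra).
(* Small enough for - K v to exceed g (u/2), which in turn exceeds g v. *)
set (v := Rmin (u / 4) (Rmin 1 (c / (2 * K)))).
assert (0 < c / (2 * K)) by (apply Rdiv_lt_0_compat; lra).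
assert (Hv : 0 < v /\ v <= u / 4 /\ v <= 1 /\ v <= c / (2 * K)).
{ unfold v. split; [repeat apply Rmin_glb_lt; lra|]. repeat split.
  - apply Rmin_l.
  - eapply Rle_trans; [apply Rmin_r|apply Rmin_l].
  - eapply Rle_trans; [apply Rmin_r|apply Rmin_r]. }
assert (H1 : g v < g (u / 2)) by (apply Hinc; lra).
assert (H2 : - (K * v) <= g v) by (apply Hb; lra).
assert (K * v <= c / 2).
{ apply Rle_trans with (K * (c / (2 * K))); [apply Rmult_le_compat_l; lra|].
  right. field. lra. }
unfold c in *. lra.
Qed.

(** The remainder r of order m + 1 satisfies, by the Riccati equation,
    u r' + 3 r = - u^2 (remainder of order m of the square), whose sign is known
    by induction; and u r' + 3 r is (u^3 r)' / u^2. *)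
Lemma coth_quot_envelops m u : 0 < u -> envelops coth_ser m (u ^ 2) (coth_quot u).
Proof.
revert u. induction m as [|m IH]; intros u Hu j Hj.
- replace j with O by lia. unfold trunc. simpl. assert (H := coth_quot_bounds u Hu). lra.
- destruct (Nat.eq_dec j (S m)) as [->|Hne]; [|apply IH; [exact Hu|lia]].
  clear Hj.
  destruct (trunc_bounded coth_ser (S m)) as [K [HK HKb]].
  set (f := fun v => (-1) ^ S m * (coth_quot v - trunc coth_ser (S m) (v ^ 2))).
  set (f' := fun v => (-1) ^ S m * ((1 / 4 - 3 * coth_quot v - v ^ 2 * coth_quot v ^ 2) / v
      - trunc (theta coth_ser) (S m) (v ^ 2) / v)).
  assert (Hf : forall v, 0 < v -> is_derive f v (f' v)).
  { intros v Hv. unfold f, f'.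
    apply (is_derive_scal (fun v => coth_quot v - trunc coth_ser (S m) (v ^ 2))).
    apply (is_derive_minus coth_quot (fun v => trunc coth_ser (S m) (v ^ 2))).
    - apply coth_quot_derive, Hv.
    - apply is_derive_trunc. lra. }
  assert (Hpos : forall v, 0 < v -> 0 < v * f' v + 3 * f v).
  { intros v Hv.
    assert (Ht : trunc (theta coth_ser) (S m) (v ^ 2) = 1 / 4 - 3 * trunc coth_ser (S m) (v ^ 2)
       - v ^ 2 * trunc (coth_ser * coth_ser)%S m (v ^ 2)).
    { assert (H := f_equal (fun a => trunc a (S m) (v ^ 2)) coth_ser_eq). cbv beta in H.
      rewrite trunc_cst, !trunc_add, trunc_X, trunc_cst_conv in H. lra. }
    unfold f, f'. rewrite Ht.
    set (T := trunc (coth_ser * coth_ser)%S m (v ^ 2)).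
    set (T1 := trunc coth_ser (S m) (v ^ 2)).
    replace (v * ((-1) ^ S m * ((1 / 4 - 3 * coth_quot v - v ^ 2 * coth_quot v ^ 2) / v -
      (1 / 4 - 3 * T1 - v ^ 2 * T) / v)) + 3 * ((-1) ^ S m * (coth_quot v - T1))) with
      (v ^ 2 * ((-1) ^ m * (coth_quot v * coth_quot v - T))) by (simpl; field; lra).
    assert (Hx : 0 < v ^ 2) by nra.
    apply Rmult_lt_0_compat; [exact Hx|].
    assert (H1 := trunc_mul_sign coth_ser coth_ser m (v ^ 2) (coth_quot v) Hx (alternating_weakly _ coth_alternating) (IH v Hv)).
    assert (H2 := IH v Hv m (Nat.le_refl m)).
    assert (H3 := proj1 (coth_quot_bounds v Hv)).
    fold T in H1. set (T2 := trunc coth_ser m (v ^ 2)) in *.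
    replace ((-1) ^ m * (coth_quot v * coth_quot v - T)) with
      ((-1) ^ m * (coth_quot v - T2) * coth_quot v + (-1) ^ m * (T2 * coth_quot v - T)) by ring.
    nra. }
  assert (Hg : 0 < u ^ 3 * f u).
  { apply (pos_of_incr (fun v => v ^ 3 * f v) (fun v => v ^ 2 * (v * f' v + 3 * f v)) (1 + K)).
    - lra.
    - intros v Hv. evar_last.
      + apply (is_derive_mult (fun v => v ^ 3) f v (3 * v ^ 2) (f' v)).
        * auto_derive; [exact I|ring].
        * apply Hf, Hv.
        * intros; apply Rmult_comm.
      + unfold plus, mult; simpl. ring.
    - intros v Hv. apply Rmult_lt_0_compat; [nra|apply Hpos, Hv].
    - intros v Hv. unfold f.
      assert (Hb : Rabs ((-1) ^ S m * (coth_quot v - trunc coth_ser (S m) (v ^ 2))) <= / (2 * v) + K).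
      { rewrite Rabs_mult, pow_1_abs, Rmult_1_l.
        eapply Rle_trans; [apply Rabs_triang|]. rewrite Rabs_Ropp.
        apply Rplus_le_compat.
        - assert (H := coth_quot_bounds v (proj1 Hv)). rewrite Rabs_pos_eq; lra.
        - apply HKb. nra. }
      apply Rabs_le_between in Hb. destruct Hb as [Hb _].
      assert (H3 : 0 < v ^ 3) by (apply pow_lt; lra).
      apply Rle_trans with (v ^ 3 * - (/ (2 * v) + K)); [|apply Rmult_le_compat_l; lra].
      replace (v ^ 3 * - (/ (2 * v) + K)) with (- (v * (v / 2 + K * v ^ 2))) by (field; lra).
      apply Ropp_le_contravar. rewrite (Rmult_comm (1 + K)).
      assert (v ^ 2 <= 1) by nra. assert (K * v ^ 2 <= K * 1) by (apply Rmult_le_compat_l; lra).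
      apply Rmult_le_compat_l; lra.
    - exact Hu. }
  unfold f in Hg. assert (0 < u ^ 3) by (apply pow_lt, Hu).
  apply (Rmult_lt_reg_l (u ^ 3)); [lra|]. rewrite Rmult_0_r. exact Hg.
Qed.

Lemma two_sinh_near_0 v : 0 < v <= 1 -> v <= two_sinh v <= v * (1 + v).
Proof.
intros Hv. split.
- assert (H := incr_pos (fun u => two_sinh u - u) (fun u => cosh_half u - 1) v (proj1 Hv)).
  cbv beta in H. rewrite two_sinh_0 in H. apply Rlt_le, Rlt_0_minus.
  apply Rle_lt_trans with (0 - 0); [lra|]. apply H.
  + intros u _. apply (is_derive_minus two_sinh (fun u => u)); [apply two_sinh_derive|apply (is_derive_id (K := R_AbsRing))].
  + intros u Hu. assert (H1 := cosh_half_sq u). assert (H2 := two_sinh_pos u Hu). assert (H3 := cosh_half_pos u). nra.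
- destruct (coth_bounds v (proj1 Hv)) as [H _].
  apply Rle_trans with (v * cosh_half v); [lra|]. apply Rmult_le_compat_l; [lra|].
  assert (Hm : exp (v / 2) * exp (- (v / 2)) = 1) by (rewrite <- exp_plus, Rplus_opp_r; apply exp_0).
  assert (H1 := exp_ineq1_le (- (v / 2))).
  assert (H2 : exp (- (v / 2)) <= exp (v / 2)).
  { left. apply exp_increasing. lra. }
  assert (H3 := exp_pos (v / 2)).
  unfold cosh_half. apply Rle_trans with (exp (v / 2)); [lra|].
  assert (exp (v / 2) * (1 - v / 2) <= 1) by nra.
  assert (exp (v / 2) * (1 - v / 2) <= (1 + v) * (1 - v / 2)) by nra.
  apply (Rmult_le_reg_r (1 - v / 2)); lra.
Qed.

(** The product p of (2/u) sinh (u/2) with a truncation of its inverse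
    satisfies p(0) = 1, and u p' is a multiple of
    coth_quot * truncation - (truncated product), so that p is monotone. *)
Lemma csch_trunc_sign m u : 0 < u ->
  0 < (-1) ^ m * (1 - two_sinh u / u * trunc csch_ser m (u ^ 2)).
Proof.
intros Hu. destruct m as [|p].
{ unfold trunc. simpl. lra. }
set (T := fun v => trunc csch_ser (S p) (v ^ 2)).
destruct (trunc_bounded (fun n => csch_ser (S n)) p) as [K [HK HKb]].
assert (HT : forall v, T v = 1 + v ^ 2 * trunc (fun n => csch_ser (S n)) p (v ^ 2)).
{ intros v. unfold T, trunc. rewrite sum_below_shift. f_equal.
  - unfold csch_ser. rewrite exp_ser_0. simpl; ring.
  - rewrite <- sum_below_scal. apply sum_below_ext; intros. simpl. ring. }
assert (HT' : forall v, trunc (theta csch_ser) (S p) (v ^ 2) = - (v ^ 2 * trunc (csch_ser * coth_ser)%S p (v ^ 2))).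
{ intros v. unfold csch_ser at 1. rewrite exp_ser_eq. fold csch_ser.
  replace (- coth_ser * csch_ser)%S with (cst (-1) * (csch_ser * coth_ser))%S
    by (rewrite (sopp_cst coth_ser); ring).
  rewrite trunc_X, trunc_cst_conv. ring. }
apply (pos_of_incr (fun v => (-1) ^ S p * (1 - two_sinh v / v * T v))
  (fun v => two_sinh v * ((-1) ^ p * (T v * coth_quot v - trunc (csch_ser * coth_ser)%S p (v ^ 2)))) (1 + 2 * K)).
- lra.
- intros v Hv.
  evar_last.
  + apply (is_derive_scal (fun v => 1 - two_sinh v / v * T v)).
    apply (is_derive_minus (fun _ => 1) (fun v => two_sinh v / v * T v)); [apply is_derive_const|].
    apply (is_derive_mult (fun v => two_sinh v / v) T v).
    * apply (is_derive_div two_sinh (fun v => v)); [apply two_sinh_derive|apply (is_derive_id (K := R_AbsRing))|lra].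
    * apply is_derive_trunc. lra.
    * intros; apply Rmult_comm.
  + unfold minus, plus, opp, mult, zero, one; simpl.
    change (v * (v * 1)) with (v ^ 2).
    rewrite HT'. assert (H := cosh_half_coth_quot v Hv).
    apply (Rmult_eq_reg_l (v ^ 2)); [|apply pow_nonzero; lra].
    transitivity (-1 * (-1) ^ p * (- ((v * cosh_half v - two_sinh v) * T v - two_sinh v * v ^ 2 * trunc (csch_ser * coth_ser)%S p (v ^ 2)))).
    * field. lra.
    * rewrite H. ring.
- intros v Hv. assert (HA := two_sinh_pos v Hv). apply Rmult_lt_0_compat; [exact HA|].
  assert (Hx : 0 < v ^ 2) by nra.
  assert (H1 := trunc_mul_sign csch_ser coth_ser p (v ^ 2) (coth_quot v) Hx
    (alternating_weakly _ csch_alternating) (coth_quot_envelops p v Hv)).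
  assert (HS : T v = trunc csch_ser p (v ^ 2) + csch_ser p * (v ^ 2) ^ p) by reflexivity.
  rewrite HS.
  assert (H2 := csch_alternating p). assert (H3 := pow_lt (v ^ 2) p Hx).
  assert (H4 := proj1 (coth_quot_bounds v Hv)).
  assert (0 < (-1) ^ p * csch_ser p * (v ^ 2) ^ p * coth_quot v)
    by (apply Rmult_lt_0_compat; [apply Rmult_lt_0_compat|]; assumption).
  lra.
- intros v Hv. assert (HA := two_sinh_near_0 v Hv).
  assert (Hq : 1 <= two_sinh v / v <= 1 + v).
  { split.
    - apply (Rmult_le_reg_r v); [lra|]. field_simplify; lra.
    - apply (Rmult_le_reg_r v); [lra|]. field_simplify; lra. }
  set (y := trunc (fun n => csch_ser (S n)) p (v ^ 2)).
  assert (Hy : Rabs y <= K) by (apply HKb; nra).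
  apply Rabs_le_between in Hy.
  assert (Hv2 : v ^ 2 * (two_sinh v / v) <= 2 * v) by nra.
  assert (Hb : Rabs (1 - two_sinh v / v * T v) <= (1 + 2 * K) * v).
  { rewrite HT. fold y. apply Rabs_le.
    assert (- (2 * v * K) <= v ^ 2 * (two_sinh v / v) * y <= 2 * v * K).
    { assert (0 <= v ^ 2 * (two_sinh v / v)) by (apply Rmult_le_pos; nra). split; nra. }
    split; nra. }
  assert (Hb2 : Rabs ((-1) ^ S p * (1 - two_sinh v / v * T v)) <= (1 + 2 * K) * v)
    by (rewrite Rabs_mult, pow_1_abs, Rmult_1_l; exact Hb).
  apply Rabs_le_between in Hb2. lra.
- exact Hu.
Qed.

(** 2 sinh (u/2) times the Legendre operator y'' + (1/2) coth (u/2) y' + y/16,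
    at y = u^(2i).  For i = 0 the factor INR (2 * i) makes the truncated
    exponents harmless. *)
Definition leg_op (i : nat) (u : R) : R :=
  two_sinh u * (INR (2 * i) * INR (2 * i - 1) * u ^ (2 * i - 2))
  + cosh_half u * (INR (2 * i) * u ^ (2 * i - 1)) + two_sinh u * (/ 16 * u ^ (2 * i)).

Lemma leg_op_E i u : 0 < u -> u ^ 2 * leg_op i u =
  two_sinh u * ((2 * INR i) * (2 * INR i) * (u ^ 2) ^ i + u ^ 2 * coth_quot u * (2 * INR i * (u ^ 2) ^ i)
     + / 16 * (u ^ 2 * (u ^ 2) ^ i)).
Proof.
intros Hu. assert (H := cosh_half_coth_quot u Hu). unfold leg_op.
destruct i as [|i].
- simpl. ring.
- replace (2 * S i - 2)%nat with (2 * i)%nat by lia.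
  replace (2 * S i - 1)%nat with (S (2 * i)) by lia.
  replace (2 * S i)%nat with (S (S (2 * i))) by lia.
  change ((u ^ 2) ^ S i) with (u ^ 2 * (u ^ 2) ^ i).
  change (u ^ S (S (2 * i))) with (u * (u * u ^ (2 * i))).
  change (u ^ S (2 * i)) with (u * u ^ (2 * i)).
  rewrite pow_mult, !S_INR, mult_INR. change (INR 2) with 2.
  set (x := (u ^ 2) ^ i).
  transitivity (u ^ 2 * two_sinh u * ((2 * INR i + 2) * (2 * INR i + 1) * x) + u ^ 2 * (u * cosh_half u) * ((2 * INR i + 2) * x)
    + two_sinh u * (/ 16 * (u ^ 4 * x))).
  + ring.
  + rewrite H. ring.
Qed.

(** All powers up to u^(2p) cancel, by [leg_ser_eq]; what is left is a remainder
    of the product coth_ser * theta leg_ser and the last term of y/16, and both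
    have the sign (-1)^p. *)
Lemma leg_op_sign p u : 0 < u ->
  0 < (-1) ^ p * sum_below (fun i => leg_ser i * leg_op i u) (S p).
Proof.
intros Hu. assert (HA := two_sinh_pos u Hu). assert (Hx : 0 < u ^ 2) by nra.
apply (Rmult_lt_reg_l (u ^ 2)); [exact Hx|]. rewrite Rmult_0_r.
rewrite <- Rmult_assoc, (Rmult_comm (u ^ 2)), Rmult_assoc, <- sum_below_scal.
rewrite (sum_below_ext _ (fun i => two_sinh u * (theta (theta leg_ser) i * (u ^ 2) ^ i
  + u ^ 2 * coth_quot u * (theta leg_ser i * (u ^ 2) ^ i) + u ^ 2 * / 16 * (leg_ser i * (u ^ 2) ^ i)))).
2:{ intros i _. unfold theta.
  replace (u ^ 2 * (leg_ser i * leg_op i u)) with (leg_ser i * (u ^ 2 * leg_op i u)) by ring.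
  rewrite leg_op_E by exact Hu. ring. }
rewrite sum_below_scal, !sum_below_plus, !sum_below_scal.
fold (trunc (theta (theta leg_ser)) (S p) (u ^ 2)).
fold (trunc (theta leg_ser) (S p) (u ^ 2)). fold (trunc leg_ser (S p) (u ^ 2)).
assert (Ht : trunc (theta (theta leg_ser)) (S p) (u ^ 2) =
  - (u ^ 2 * (trunc (theta leg_ser * coth_ser)%S p (u ^ 2)) + / 16 * (u ^ 2 * trunc leg_ser p (u ^ 2)))).
{ assert (H := f_equal (fun a => trunc a (S p) (u ^ 2)) leg_ser_eq). cbv beta in H.
  rewrite trunc_cst, !trunc_add, trunc_cst_conv, !trunc_X in H.
  rewrite (convC (theta leg_ser)). lra. }
rewrite Ht.
assert (HE := proj1 (coth_quot_bounds u Hu)).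
assert (Hw : weakly_alternating (theta leg_ser)).
{ intros i. unfold theta. assert (Hi := pos_INR i). assert (Hl := leg_alternating i). nra. }
assert (H1 := trunc_mul_sign (theta leg_ser) coth_ser p (u ^ 2) (coth_quot u) Hx Hw (coth_quot_envelops p u Hu)).
assert (HS : forall a, trunc a (S p) (u ^ 2) = trunc a p (u ^ 2) + a p * (u ^ 2) ^ p) by reflexivity.
rewrite !HS.
assert (H3 := pow_lt (u ^ 2) p Hx).
assert (H4 : 0 <= (-1) ^ p * theta leg_ser p * (u ^ 2) ^ p * coth_quot u).
{ apply Rmult_le_pos; [apply Rmult_le_pos; [apply Hw|]|]; lra. }
assert (H5 : 0 < (-1) ^ p * leg_ser p * (u ^ 2) ^ p).
{ apply Rmult_lt_0_compat; [apply leg_alternating|exact H3]. }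
set (y := (-1) ^ p) in *. set (z := (u ^ 2) ^ p) in *.
set (T1 := trunc (theta leg_ser * coth_ser)%S p (u ^ 2)) in *.
set (T2 := trunc (theta leg_ser) p (u ^ 2)) in *.
set (T3 := trunc leg_ser p (u ^ 2)) in *.
replace (y * (two_sinh u * (- (u ^ 2 * T1 + / 16 * (u ^ 2 * T3)) + u ^ 2 * coth_quot u * (T2 + theta leg_ser p * z)
   + u ^ 2 * / 16 * (T3 + leg_ser p * z)))) with
 (two_sinh u * u ^ 2 * (y * (T2 * coth_quot u - T1) + y * theta leg_ser p * z * coth_quot u + / 16 * (y * leg_ser p * z))) by ring.
apply Rmult_lt_0_compat; [apply Rmult_lt_0_compat; assumption|]. lra.
Qed.

(** * Laplace transforms *)
(** The integral of exp(-s u) f(u) over u > 0 is v.  It is stated through a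
    primitive vanishing at infinity: primitives are explicit for products of
    polynomials with exponentials, and positivity is monotonicity. *)
Definition laplace (f : R -> R) (s v : R) : Prop :=
  exists F : R -> R, (forall u, is_derive F u (exp (- (s * u)) * f u)) /\
    F 0 = - v /\ is_lim F p_infty 0.

Lemma laplace_ext f g s v : (forall u, f u = g u) -> laplace f s v -> laplace g s v.
Proof.
intros H [F [HF HF']]. exists F. split; [|exact HF'].
intros u. rewrite <- H. apply HF.
Qed.

Lemma laplace_plus f g s v w : laplace f s v -> laplace g s w -> laplace (fun u => f u + g u) s (v + w).
Proof.
intros [F [F1 [F2 F3]]] [G [G1 [G2 G3]]]. exists (fun u => F u + G u).
split; [|split].
- intros u. rewrite Rmult_plus_distr_l. apply (is_derive_plus F G); auto.
- lra.
- replace 0 with (0 + 0) by ring. apply (is_lim_plus' F G); assumption.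
Qed.

Lemma laplace_scal c f s v : laplace f s v -> laplace (fun u => c * f u) s (c * v).
Proof.
intros [F [F1 [F2 F3]]]. exists (fun u => c * F u). split; [|split].
- intros u. replace (exp (- (s * u)) * (c * f u)) with (c * (exp (- (s * u)) * f u)) by ring.
  apply (is_derive_scal F); auto.
- rewrite F2. ring.
- replace 0 with (c * 0) by ring. apply (is_lim_scal_l F c p_infty 0). exact F3.
Qed.

Lemma laplace_sum (c : nat -> R) (f : nat -> R -> R) s (v : nat -> R) n :
  (forall i, (i < n)%nat -> laplace (f i) s (v i)) ->
  laplace (fun u => sum_below (fun i => c i * f i u) n) s (sum_below (fun i => c i * v i) n).
Proof.
induction n as [|n IH]; intros H; simpl.
- exists (fun _ => 0). split; [|split].
  + intros u. rewrite Rmult_0_r. apply (is_derive_const 0).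
  + ring.
  + apply is_lim_const.
- apply (laplace_plus _ (fun u => c n * f n u)); [apply IH; auto|apply laplace_scal; auto].
Qed.

Lemma laplace_shift a f s v : laplace f (s - a) v -> laplace (fun u => exp (a * u) * f u) s v.
Proof.
intros [F [F1 F2]]. exists F. split; [|exact F2].
intros u. rewrite <- Rmult_assoc, <- exp_plus.
replace (- (s * u) + a * u) with (- ((s - a) * u)) by ring. apply F1.
Qed.

Lemma laplace_two_sinh f s v w : laplace f (s - 1 / 2) v -> laplace f (s + 1 / 2) w ->
  laplace (fun u => two_sinh u * f u) s (v - w).
Proof.
intros H1 H2.
apply (laplace_ext (fun u => exp (1 / 2 * u) * f u + -1 * (exp (- (1 / 2) * u) * f u))).
- intros u. unfold two_sinh. replace (1 / 2 * u) with (u / 2) by field.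
  replace (- (1 / 2) * u) with (- (u / 2)) by field. ring.
- replace (v - w) with (v + -1 * w) by ring.
  apply laplace_plus; [|apply laplace_scal]; apply laplace_shift; [exact H1|].
  replace (s - - (1 / 2)) with (s + 1 / 2) by ring. exact H2.
Qed.

Lemma laplace_cosh_half f s v w : laplace f (s - 1 / 2) v -> laplace f (s + 1 / 2) w ->
  laplace (fun u => cosh_half u * f u) s (/ 2 * (v + w)).
Proof.
intros H1 H2.
apply (laplace_ext (fun u => / 2 * (exp (1 / 2 * u) * f u + exp (- (1 / 2) * u) * f u))).
- intros u. unfold cosh_half. replace (1 / 2 * u) with (u / 2) by field.
  replace (- (1 / 2) * u) with (- (u / 2)) by field. field.
- apply laplace_scal. apply laplace_plus; apply laplace_shift; [exact H1|].
  replace (s - - (1 / 2)) with (s + 1 / 2) by ring. exact H2.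
Qed.

(** exp (s u) >= (s u / (k+1))^(k+1), as exp t >= t at t = s u / (k+1). *)
Lemma pow_exp_lim s k : 0 < s -> is_lim (fun u => exp (- (s * u)) * u ^ k) p_infty 0.
Proof.
intros Hs.
set (c := s / INR (S k)).
assert (Hn : 0 < INR (S k)) by (apply lt_0_INR; lia).
assert (Hc : 0 < c) by (apply Rdiv_lt_0_compat; assumption).
assert (Hck : 0 < c ^ S k) by (apply pow_lt; exact Hc).
apply (is_lim_le_le_loc (fun _ => 0) (fun u => / c ^ S k * / u)).
- exists 0. intros u Hu. split.
  + apply Rmult_le_pos; [left; apply exp_pos|apply pow_le; lra].
  + assert (He : exp (s * u) = exp (c * u) ^ S k).
    { assert (Hp : forall n t, exp (INR n * t) = exp t ^ n).
      { intros n t. induction n as [|n IHn]; [simpl; rewrite Rmult_0_l; apply exp_0|].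
        rewrite S_INR, <- tech_pow_Rmult, <- IHn, <- exp_plus. f_equal. ring. }
      rewrite <- Hp. f_equal. unfold c. field. lra. }
    assert (Hcu : 0 < c * u) by (apply Rmult_lt_0_compat; lra).
    assert (H1 : c * u <= exp (c * u)) by (assert (H := exp_ineq1_le (c * u)); lra).
    assert (H2 : (c * u) ^ S k <= exp (s * u)) by (rewrite He; apply pow_incr; lra).
    rewrite exp_Ropp. rewrite Rpow_mult_distr in H2.
    assert (Huk : 0 < u ^ k) by (apply pow_lt; lra).
    assert (Hes := exp_pos (s * u)).
    apply (Rmult_le_reg_r (exp (s * u) * c ^ S k * u)).
    * apply Rmult_lt_0_compat; [apply Rmult_lt_0_compat; assumption|exact Hu].
    * replace (/ exp (s * u) * u ^ k * (exp (s * u) * c ^ S k * u)) with (c ^ S k * u ^ S k) 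
        by (simpl; field; lra).
      replace (/ c ^ S k * / u * (exp (s * u) * c ^ S k * u)) with (exp (s * u)) by (field; lra).
      exact H2.
- apply is_lim_const.
- replace (Finite 0) with (Rbar_mult (/ c ^ S k) 0) by (simpl; f_equal; ring).
  apply (is_lim_scal_l (fun u => / u)).
  apply (is_lim_inv (fun u => u) p_infty p_infty); [apply is_lim_id|discriminate].
Qed.

Lemma laplace_pow k s : 0 < s -> laplace (fun u => u ^ k) s (INR (fact k) / s ^ S k).
Proof.
intros Hs. induction k as [|k [F [F1 [F2 F3]]]].
- exists (fun u => - / s * (exp (- (s * u)) * u ^ 0)). split; [|split].
  + intros u. auto_derive; [exact I|]. simpl. field. lra.
  + simpl. rewrite Rmult_0_r, Ropp_0, exp_0. field. lra.
  + replace (Finite 0) with (Rbar_mult (- / s) 0) by (simpl; f_equal; ring).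
    apply (is_lim_scal_l (fun u => exp (- (s * u)) * u ^ 0)). apply pow_exp_lim, Hs.
- exists (fun u => / s * (INR (S k) * F u - exp (- (s * u)) * u ^ S k)). split; [|split].
  + intros u. evar_last.
    * apply (is_derive_scal (fun u => INR (S k) * F u - exp (- (s * u)) * u ^ S k)).
      apply (is_derive_minus (fun u => INR (S k) * F u) (fun u => exp (- (s * u)) * u ^ S k)).
      -- apply (is_derive_scal F), F1.
      -- auto_derive; [exact I|reflexivity].
    * unfold minus, plus, opp. simpl pred. cbn -[INR pow]. rewrite <- (tech_pow_Rmult u k). 
      change (match k with 0%nat => 1 | S _ => INR k + 1 end) with (INR (S k)). field. lra.
  + rewrite F2, fact_simpl, mult_INR, pow_i by lia. rewrite <- (tech_pow_Rmult s (S k)).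
    assert (0 < s ^ S k) by (apply pow_lt, Hs). field. lra.
  + replace (Finite 0) with (Rbar_mult (/ s) (Rbar_minus (Rbar_mult (INR (S k)) 0) 0))
      by (simpl; f_equal; ring).
    apply (is_lim_scal_l (fun u => INR (S k) * F u - exp (- (s * u)) * u ^ S k)).
    apply (is_lim_minus (fun u => INR (S k) * F u) (fun u => exp (- (s * u)) * u ^ S k) p_infty
      (Rbar_mult (INR (S k)) 0) 0).
    * apply (is_lim_scal_l F). exact F3.
    * apply pow_exp_lim, Hs.
    * unfold is_Rbar_minus, is_Rbar_plus. simpl. do 2 f_equal; ring.
Qed.

Lemma laplace_pos f s v : laplace f s v -> (forall u, 0 < u -> 0 < f u) -> 0 < v.
Proof.
intros [F [F1 [F2 F3]]] Hf.
assert (Hinc : forall a b, 0 <= a < b -> F a < F b).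
{ intros a b Hab. destruct (MVT_cor2 F (fun u => exp (- (s * u)) * f u) a b) as [c [Hc1 Hc2]].
  - lra.
  - intros c _. apply is_derive_Reals, F1.
  - assert (0 < exp (- (s * c)) * f c) by (apply Rmult_lt_0_compat; [apply exp_pos|apply Hf; lra]).
    nra. }
assert (H1 : F 0 < F 1) by (apply Hinc; lra).
assert (H2 : Rbar_le (F 1) 0).
{ apply (is_lim_le_loc (fun _ => F 1) F p_infty (F 1) 0).
  - exists 1. intros u Hu. left. apply Hinc. lra.
  - apply is_lim_const.
  - exact F3. }
simpl in H2. lra.
Qed.

(** The Legendre operator is dual to the first-order recurrence of the steps of
    PI * G_n, here between M = K - 1/2 and M = K + 1/2. *)
Lemma laplace_leg_op i K : 1 / 2 < K ->
  laplace (leg_op i) K (INR (fact (2 * i)) *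
   ((K - 1 / 2 + 1 / 4) ^ 2 / (K - 1 / 2) ^ (2 * i + 1)
    - (K + 1 / 2 - 1 / 4) ^ 2 / (K + 1 / 2) ^ (2 * i + 1))).
Proof.
intros HK. assert (HP : 0 < K - 1 / 2) by lra. assert (HQ : 0 < K + 1 / 2) by lra.
assert (H0 := laplace_two_sinh _ _ _ _ (laplace_scal (/ 16) _ _ _ (laplace_pow (2 * i) _ HP))
   (laplace_scal (/ 16) _ _ _ (laplace_pow (2 * i) _ HQ))).
replace (2 * i + 1)%nat with (S (2 * i)) by lia.
destruct i as [|i].
- apply (laplace_ext (fun u => two_sinh u * (/ 16 * u ^ (2 * 0)))).
  + intros u. unfold leg_op. simpl. ring.
  + evar_last; [exact H0|]. simpl. field. lra.
- assert (H1 := laplace_two_sinh _ _ _ _ (laplace_scal (INR (2 * S i) * INR (2 * S i - 1)) _ _ _ (laplace_pow (2 * i) _ HP))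
   (laplace_scal (INR (2 * S i) * INR (2 * S i - 1)) _ _ _ (laplace_pow (2 * i) _ HQ))).
  assert (H2 := laplace_cosh_half _ _ _ _ (laplace_scal (INR (2 * S i)) _ _ _ (laplace_pow (S (2 * i)) _ HP))
   (laplace_scal (INR (2 * S i)) _ _ _ (laplace_pow (S (2 * i)) _ HQ))).
  assert (H := laplace_plus _ _ _ _ _ (laplace_plus _ _ _ _ _ H1 H2) H0).
  evar_last.
  + eapply laplace_ext; [|exact H]. intros u. unfold leg_op.
    replace (2 * S i - 2)%nat with (2 * i)%nat by lia.
    replace (2 * S i - 1)%nat with (S (2 * i)) by lia. ring.
  + replace (2 * S i - 1)%nat with (S (2 * i)) by lia.
    replace (2 * S i)%nat with (S (S (2 * i))) by lia.
    rewrite !(fact_simpl (S (2 * i))), (fact_simpl (2 * i)), !mult_INR.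
    rewrite <- !(tech_pow_Rmult _ (S (S (2 * i)))), <- !(tech_pow_Rmult _ (S (2 * i))), <- !(tech_pow_Rmult _ (2 * i)).
    assert (0 < (K - 1 / 2) ^ (2 * i)) by (apply pow_lt; lra).
    assert (0 < (K + 1 / 2) ^ (2 * i)) by (apply pow_lt; lra).
    set (x := (K - 1 / 2) ^ (2 * i)) in *. set (y := (K + 1 / 2) ^ (2 * i)) in *.
    rewrite !S_INR. set (n := INR (2 * i)). set (ff := INR (fact (2 * i))).
    field. repeat split; lra.
Qed.

(** The Laplace transform of the truncated series of h, in the variable M. *)
Definition leg_trunc (m : nat) (M : R) : R :=
  sum_below (fun i => leg_ser i * (INR (fact (2 * i)) / M ^ (2 * i + 1))) m.

Lemma leg_trunc_step p M : 0 < M ->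
  0 < (-1) ^ p * ((M + 1 / 4) ^ 2 * leg_trunc (S p) M - (M + 3 / 4) ^ 2 * leg_trunc (S p) (M + 1)).
Proof.
intros HM.
assert (HK : 1 / 2 < M + 1 / 2) by lra.
assert (H := laplace_scal ((-1) ^ p) _ _ _ (laplace_sum leg_ser leg_op _ _ (S p) (fun i _ => laplace_leg_op i _ HK))).
apply laplace_pos in H; [|intros u Hu; apply leg_op_sign, Hu].
replace (M + 1 / 2 - 1 / 2) with M in H by ring.
replace (M + 1 / 2 + 1 / 2) with (M + 1) in H by field.
replace (M + 1 - 1 / 4) with (M + 3 / 4) in H by field.
evar_last; [exact H|]. f_equal.
unfold leg_trunc, Rminus.
rewrite Ropp_mult_distr_l, <- !sum_below_scal, <- sum_below_plus.
apply sum_below_ext; intros i _. unfold Rdiv. ring.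
Qed.

(** * The limit of PI * G_n - ln N *)

Definition wallis (k : nat) : R := RInt (fun t => sin t ^ k) 0 (PI / 2).
Definition log_wallis (k : nat) : R := RInt (fun t => sin t ^ k * ln (1 + sin t)) 0 (PI / 2).

Lemma PI2_pos : 0 < PI / 2.
Proof. assert (H := PI_RGT_0). lra. Qed.

Lemma sin_01 t : 0 <= t <= PI / 2 -> 0 <= sin t <= 1.
Proof.
intros Ht. split; [apply sin_ge_0; assert (H := PI_RGT_0); lra|apply SIN_bound].
Qed.

Lemma continuous_ex_derive (f : R -> R) (t : R) : ex_derive f t -> continuous f t.
Proof. apply (ex_derive_continuous f t). Qed.

Lemma cont_sin_pow k t : continuous (fun t => sin t ^ k) t.
Proof. apply continuous_ex_derive. auto_derive. exact I. Qed.

Lemma cont_sin_pow_ln k t : 0 <= t <= PI / 2 -> continuous (fun t => sin t ^ k * ln (1 + sin t)) t.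
Proof.
intros Ht. apply continuous_ex_derive. auto_derive. assert (H := sin_01 t Ht). lra.
Qed.

Lemma is_RInt_wallis k : is_RInt (fun t => sin t ^ k) 0 (PI / 2) (wallis k).
Proof.
apply (RInt_correct (fun t => sin t ^ k)). apply (ex_RInt_continuous (V := R_CompleteNormedModule)). intros; apply cont_sin_pow.
Qed.

Lemma is_RInt_log_wallis k :
  is_RInt (fun t => sin t ^ k * ln (1 + sin t)) 0 (PI / 2) (log_wallis k).
Proof.
apply (RInt_correct (fun t => sin t ^ k * ln (1 + sin t))).
apply (ex_RInt_continuous (V := R_CompleteNormedModule)). intros t Ht.
assert (H := PI2_pos). rewrite Rmin_left, Rmax_right in Ht by lra. apply cont_sin_pow_ln, Ht.
Qed.

Lemma is_RInt_primitive (f df : R -> R) :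
  (forall t, 0 <= t <= PI / 2 -> is_derive f t (df t)) ->
  (forall t, 0 <= t <= PI / 2 -> continuous df t) ->
  is_RInt df 0 (PI / 2) (f (PI / 2) - f 0).
Proof.
intros H1 H2. assert (H := PI2_pos).
apply (is_RInt_derive f df); intros t Ht; rewrite Rmin_left, Rmax_right in Ht by lra; auto.
Qed.

Lemma is_RInt_lin (f g : R -> R) a b x y :
  is_RInt f 0 (PI / 2) x -> is_RInt g 0 (PI / 2) y ->
  is_RInt (fun t => a * f t + b * g t) 0 (PI / 2) (a * x + b * y).
Proof.
intros Hf Hg.
apply (is_RInt_plus (V := R_NormedModule) (fun t => a * f t) (fun t => b * g t));
 apply (is_RInt_scal (V := R_NormedModule)); assumption.
Qed.

Lemma is_RInt_mono (f g : R -> R) x y :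
  is_RInt f 0 (PI / 2) x -> is_RInt g 0 (PI / 2) y ->
  (forall t, 0 <= t <= PI / 2 -> f t <= g t) -> x <= y.
Proof.
intros Hf Hg H. 
apply (is_RInt_le f g 0 (PI / 2)); [left; apply PI2_pos|exact Hf|exact Hg|].
intros t Ht. apply H. lra.
Qed.

Lemma is_RInt_uniq (f : R -> R) x y :
  is_RInt f 0 (PI / 2) x -> is_RInt f 0 (PI / 2) y -> x = y.
Proof.
intros Hx Hy. rewrite <- (is_RInt_unique _ _ _ _ Hx). apply is_RInt_unique, Hy.
Qed.

Lemma primitive_eq (f df : R -> R) x :
  is_RInt df 0 (PI / 2) x ->
  (forall t, 0 <= t <= PI / 2 -> is_derive f t (df t)) ->
  (forall t, 0 <= t <= PI / 2 -> continuous df t) -> x = f (PI / 2) - f 0.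
Proof.
intros Hx H1 H2. apply (is_RInt_uniq df); [exact Hx|]. apply is_RInt_primitive; assumption.
Qed.

Lemma cos_sq t : cos t ^ 2 = 1 - sin t ^ 2.
Proof. assert (H := sin2_cos2 t). unfold Rsqr in H. lra. Qed.

Lemma wallis_rec k : INR (k + 2) * wallis (k + 2) = INR (k + 1) * wallis k.
Proof.
assert (H1 := is_RInt_lin _ _ (INR (k + 2)) (- INR (k + 1)) _ _ (is_RInt_wallis (k + 2)) (is_RInt_wallis k)).
assert (E := primitive_eq (fun t => - cos t * sin t ^ (k + 1)) _ _ H1). cbv beta in E.
rewrite cos_PI2, sin_0, pow_i in E by lia.
enough (INR (k + 2) * wallis (k + 2) + - INR (k + 1) * wallis k = 0) by lra.
rewrite E; [ring| |].
- intros t _. auto_derive; [exact I|].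
  replace (k + 1)%nat with (S k) by lia. replace (k + 2)%nat with (S (S k)) by lia.
  simpl pred. rewrite !S_INR. assert (H := cos_sq t).
  transitivity (sin t * sin t ^ S k - (INR k + 1) * (cos t ^ 2) * sin t ^ k); [ring|].
  rewrite H. simpl. ring.
- intros t _. apply continuous_ex_derive. auto_derive. exact I.
Qed.

Lemma wallis_0 : wallis 0 = PI / 2.
Proof.
apply (is_RInt_uniq _ _ _ (is_RInt_wallis 0)).
evar_last; [apply (is_RInt_primitive (fun t => t))|ring].
- intros t _. auto_derive; [exact I|reflexivity].
- intros t _. apply continuous_ex_derive. auto_derive. exact I.
Qed.

Lemma wallis_1 : wallis 1 = 1.
Proof.
apply (is_RInt_uniq _ _ _ (is_RInt_wallis 1)).
evar_last; [apply (is_RInt_primitive (fun t => - cos t))|rewrite cos_PI2, cos_0; ring].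
- intros t _. auto_derive; [exact I|]. ring.
- intros t _. apply cont_sin_pow.
Qed.

Lemma wallis_decr k : wallis (S k) <= wallis k.
Proof.
apply (is_RInt_mono _ _ _ _ (is_RInt_wallis (S k)) (is_RInt_wallis k)).
intros t Ht. assert (H := sin_01 t Ht). simpl.
assert (0 <= sin t ^ k) by (apply pow_le; lra). nra.
Qed.

Lemma wallis_odd n : INR (2 * n + 1) * wallis (2 * n + 1) * odd_even_ratio n = 1.
Proof.
induction n as [|n IH]; [simpl; rewrite wallis_1; ring|].
assert (H := wallis_rec (2 * n + 1)).
replace (2 * n + 1 + 2)%nat with (2 * S n + 1)%nat in H by lia.
rewrite H.
change (odd_even_ratio (S n)) with (odd_even_ratio n * (INR (2 * S n - 1) / INR (2 * S n))).
replace (2 * S n - 1)%nat with (2 * n + 1)%nat by lia.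
replace (2 * n + 1 + 1)%nat with (2 * S n)%nat by lia.
transitivity (INR (2 * n + 1) * wallis (2 * n + 1) * odd_even_ratio n); [|exact IH].
field. apply not_0_INR. lia.
Qed.

Lemma wallis_even n : wallis (2 * n) = PI / 2 * odd_even_ratio n.
Proof.
induction n as [|n IH]; [simpl; rewrite wallis_0; ring|].
assert (H := wallis_rec (2 * n)).
replace (2 * n + 2)%nat with (2 * S n)%nat in H by lia.
rewrite IH in H. assert (0 < INR (2 * S n)) by (apply lt_0_INR; lia).
apply (Rmult_eq_reg_l (INR (2 * S n))); [|lra]. rewrite H.
change (odd_even_ratio (S n)) with (odd_even_ratio n * (INR (2 * S n - 1) / INR (2 * S n))).
replace (2 * S n - 1)%nat with (2 * n + 1)%nat by lia. field. lra.
Qed.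

Lemma odd_even_ratio_pos n : 0 < odd_even_ratio n.
Proof.
induction n as [|n IH]; [simpl; lra|].
change (odd_even_ratio (S n)) with (odd_even_ratio n * (INR (2 * S n - 1) / INR (2 * S n))).
apply Rmult_lt_0_compat; [exact IH|]. apply Rdiv_lt_0_compat; apply lt_0_INR; lia.
Qed.

(** D_n = (Gamma(M + 1/4) / Gamma(M + 3/4))^2 at M = n + 1/4, for n >= 1 the
    difference PI * G_n - PI * G_(n-1). *)
Definition landau_step (n : nat) : R := PI * odd_even_ratio n ^ 2.

Lemma landau_step_pos n : 0 < landau_step n.
Proof.
apply Rmult_lt_0_compat; [apply PI_RGT_0|apply pow_lt, odd_even_ratio_pos].
Qed.

Lemma wallis_ratio n : INR (2 * n + 1) * wallis (2 * n + 1) * landau_step n = 2 * wallis (2 * n).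
Proof.
rewrite wallis_even. unfold landau_step.
transitivity (PI * odd_even_ratio n * (INR (2 * n + 1) * wallis (2 * n + 1) * odd_even_ratio n)); [ring|].
rewrite wallis_odd. field.
Qed.

Lemma wallis_pos k : 0 < wallis k.
Proof.
assert (H : forall n, 0 < wallis (2 * n + 1)).
{ intros n. assert (H := wallis_odd n). assert (Ha := odd_even_ratio_pos n).
  assert (Hn : 0 < INR (2 * n + 1)) by (apply lt_0_INR; lia).
  destruct (Rlt_le_dec 0 (wallis (2 * n + 1))) as [Hl|Hl]; [exact Hl|exfalso].
  assert (0 < INR (2 * n + 1) * odd_even_ratio n) by (apply Rmult_lt_0_compat; assumption). nra. }
destruct (Nat.Even_or_Odd k) as [[n ->]|[n ->]]; [|apply H].
apply Rlt_le_trans with (wallis (S (2 * n))); [|apply wallis_decr].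
replace (S (2 * n)) with (2 * n + 1)%nat by lia. apply H.
Qed.

Lemma landau_step_bounds n :
  2 <= (2 * INR n + 1) * landau_step n <= 2 * (1 + / (2 * INR n + 1)).
Proof.
assert (H := wallis_ratio n). assert (H1 := wallis_decr (2 * n)). assert (H2 := wallis_decr (2 * n + 1)).
assert (H3 := wallis_rec (2 * n)). assert (Hp := wallis_pos (2 * n + 1)).
replace (S (2 * n + 1)) with (2 * n + 2)%nat in H2 by lia.
replace (S (2 * n)) with (2 * n + 1)%nat in H1 by lia.
rewrite !plus_INR, mult_INR in *. change (INR 2) with 2 in *. change (INR 1) with 1 in *.
assert (Hn := pos_INR n).
set (x := INR n) in *. set (w := wallis (2 * n + 1)) in *. set (w2 := wallis (2 * n + 2)) in *.
split; apply (Rmult_le_reg_l w); try exact Hp.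
- lra.
- replace (w * ((2 * x + 1) * landau_step n)) with (2 * wallis (2 * n)) by lra.
  apply (Rmult_le_reg_l (2 * x + 1)); [lra|].
  replace ((2 * x + 1) * (w * (2 * (1 + / (2 * x + 1))))) with (2 * ((2 * x + 2) * w)) by (field; lra).
  replace ((2 * x + 1) * (2 * wallis (2 * n))) with (2 * ((2 * x + 2) * w2)) by lra.
  apply Rmult_le_compat_l; [lra|]. apply Rmult_le_compat_l; lra.
Qed.

(** Integrate the derivative of - cos t sin^(n+1) t ln (1 + sin t); the
    denominator 1 + sin t disappears because cos^2 = (1 - sin)(1 + sin). *)
Lemma log_wallis_rec n :
  INR (n + 2) * log_wallis (n + 2) = INR (n + 1) * log_wallis n + wallis (n + 1) - wallis (n + 2).
Proof.
assert (H1 := is_RInt_lin _ _ (INR (n + 2)) (- INR (n + 1)) _ _ (is_RInt_log_wallis (n + 2)) (is_RInt_log_wallis n)).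
assert (H1' := is_RInt_lin _ _ 1 (- 1) _ _ (is_RInt_wallis (n + 2)) (is_RInt_wallis (n + 1))).
assert (H3 := is_RInt_lin _ _ 1 1 _ _ H1 H1'). cbv beta in H3.
assert (E := primitive_eq (fun t => - cos t * (sin t ^ (n + 1) * ln (1 + sin t))) _ _ H3).
cbv beta in E. rewrite cos_PI2, sin_0, pow_i in E by lia.
match type of E with _ -> _ -> ?l = _ => enough (l = 0) by lra end.
rewrite E; [ring| |].
- intros t Ht. assert (Hs := sin_01 t Ht). auto_derive; [lra|].
  replace (n + 1)%nat with (S n) by lia. replace (n + 2)%nat with (S (S n)) by lia.
  simpl pred. rewrite !S_INR. assert (H := cos_sq t).
  set (s := sin t) in *. set (L := ln (1 + s)).
  transitivity (s * (s ^ S n * L) - cos t ^ 2 * ((INR n + 1) * s ^ n * L + s ^ S n / (1 + s))).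
  + simpl. field. lra.
  + rewrite H. simpl. field. lra.
- intros t Ht. assert (Hs := sin_01 t Ht). apply continuous_ex_derive. auto_derive. lra.
Qed.

Lemma log_wallis_1 : log_wallis 1 = PI / 2 - 1.
Proof.
assert (H1 := is_RInt_lin _ _ 1 1 _ _ (is_RInt_log_wallis 1) (is_RInt_wallis 1)).
assert (H3 := is_RInt_lin _ _ 1 (-1) _ _ H1 (is_RInt_wallis 0)). cbv beta in H3.
assert (E := primitive_eq (fun t => - cos t * ln (1 + sin t)) _ _ H3).
cbv beta in E. rewrite cos_PI2, sin_0, Rplus_0_r, ln_1, wallis_1, wallis_0 in E.
match type of E with _ -> _ -> ?l = _ => enough (l = 0) by lra end.
rewrite E; [ring| |].
- intros t Ht. assert (Hs := sin_01 t Ht). auto_derive; [lra|].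
  assert (H := cos_sq t).
  set (s := sin t) in *. set (L := ln (1 + s)).
  transitivity (s * L - cos t ^ 2 / (1 + s)).
  + field. lra.
  + rewrite H. simpl. field. lra.
- intros t Ht. assert (Hs := sin_01 t Ht). apply continuous_ex_derive. auto_derive. lra.
Qed.

Lemma landau_S n : landau (S n) = landau n + odd_even_ratio (S n) ^ 2.
Proof. unfold landau. rewrite sum_n_Sm by lia. reflexivity. Qed.

(** Both sides have the same steps: dividing [log_wallis_rec] by the Wallis
    integral turns the difference of two Wallis integrals into
    landau_step / 2 - 1 / (2n + 1). *)
Lemma landau_log_wallis n :
  PI * landau n = 2 * (log_wallis (2 * n + 1) / wallis (2 * n + 1))
    + sum_below (fun k => 2 / (2 * INR k + 1)) (S n).
Proof.
induction n as [|n IH].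
- simpl. unfold landau. rewrite sum_n_n. simpl. rewrite wallis_1, log_wallis_1. field.
- rewrite landau_S, Rmult_plus_distr_l, IH.
  fold (landau_step (S n)).
  assert (H1 := wallis_ratio (S n)). assert (H2 := log_wallis_rec (2 * n + 1)).
  assert (H3 := wallis_rec (2 * n + 1)).
  assert (Hp1 := wallis_pos (2 * n + 1)). assert (Hp2 := wallis_pos (2 * S n + 1)).
  replace (2 * n + 1 + 2)%nat with (2 * S n + 1)%nat in * by lia.
  replace (2 * n + 1 + 1)%nat with (2 * S n)%nat in * by lia.
  cbn [sum_below].
  assert (Hn := pos_INR (S n)).
  rewrite plus_INR, mult_INR in H1, H2, H3. change (INR 2) with 2 in *. change (INR 1) with 1 in *.
  set (x := INR (S n)) in *. set (w := wallis (2 * S n + 1)) in *.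
  assert (Hx : 0 < x) by (apply lt_0_INR; lia).
  replace (2 * INR (S n)) with (2 * x) by reflexivity.
  assert (Hw : wallis (2 * n + 1) = (2 * x + 1) * w / (2 * x)).
  { rewrite H3. field. lra. }
  assert (Hs : landau_step (S n) = 2 * wallis (2 * S n) / ((2 * x + 1) * w)).
  { rewrite <- H1. field. lra. }
  assert (Hl : log_wallis (2 * S n + 1) = (2 * x * log_wallis (2 * n + 1) + wallis (2 * S n) - w) / (2 * x + 1)).
  { apply (Rmult_eq_reg_l (2 * x + 1)); [|lra]. rewrite H2. field. lra. }
  assert (Hn0 := pos_INR n). rewrite Hw, Hs, Hl. field. repeat split; lra.
Qed.

(** With s = sin t, ln 2 - ln (1 + s) <= 1 - s because 2 <= (2 - s)(1 + s) and
    ln (2 - s) <= 1 - s. *)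
Lemma log_wallis_bounds k :
  ln 2 * wallis k - (wallis k - wallis (S k)) <= log_wallis k <= ln 2 * wallis k.
Proof.
split.
- assert (H1 := is_RInt_lin _ _ (ln 2 - 1) 1 _ _ (is_RInt_wallis k) (is_RInt_wallis (S k))).
  apply Rle_trans with ((ln 2 - 1) * wallis k + 1 * wallis (S k)); [right; ring|].
  apply (is_RInt_mono _ _ _ _ H1 (is_RInt_log_wallis k)).
  intros t Ht. assert (H := sin_01 t Ht).
  assert (Hp : 0 <= sin t ^ k) by (apply pow_le; lra).
  assert (Hl : ln 2 - 1 + sin t <= ln (1 + sin t)).
  { assert (Hq : ln 2 <= ln ((2 - sin t) * (1 + sin t))).
    { apply Rcomplements.ln_le; nra. }
    rewrite ln_mult in Hq by lra.
    assert (ln (2 - sin t) <= 1 - sin t).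
    { replace (2 - sin t) with (1 + (1 - sin t)) by ring.
      rewrite <- (ln_exp (1 - sin t)) at 2. apply Rcomplements.ln_le; [lra|apply exp_ineq1_le]. }
    lra. }
  simpl. nra.
- assert (H1 := is_RInt_lin _ _ (ln 2) 0 _ _ (is_RInt_wallis k) (is_RInt_wallis k)).
  apply Rle_trans with (ln 2 * wallis k + 0 * wallis k); [|right; ring].
  apply (is_RInt_mono _ _ _ _ (is_RInt_log_wallis k) H1).
  intros t Ht. assert (H := sin_01 t Ht).
  assert (Hp : 0 <= sin t ^ k) by (apply pow_le; lra).
  assert (Hl : ln (1 + sin t) <= ln 2) by (apply Rcomplements.ln_le; lra). nra.
Qed.

Lemma lim_inv_affine a b : 0 < a -> is_lim_seq (fun n => / (a * INR n + b)) 0.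
Proof.
intros Ha. replace (Finite 0) with (Rbar_inv p_infty) by reflexivity.
apply is_lim_seq_inv; [|discriminate].
apply (is_lim_seq_plus _ _ p_infty b).
- replace p_infty with (Rbar_mult a p_infty).
  + apply (is_lim_seq_scal_l INR). apply is_lim_seq_INR.
  + simpl. destruct (Rle_dec 0 a) as [H|H]; [|lra].
    destruct (Rle_lt_or_eq_dec 0 a H); [reflexivity|lra].
- apply is_lim_seq_const.
- reflexivity.
Qed.

Lemma log_wallis_lim :
  is_lim_seq (fun n => log_wallis (2 * n + 1) / wallis (2 * n + 1)) (ln 2).
Proof.
apply (is_lim_seq_le_le (fun n => ln 2 - / (2 * INR n + 3)) _ (fun _ => ln 2)).
- intros n. destruct (log_wallis_bounds (2 * n + 1)) as [H1 H2].
  assert (Hp := wallis_pos (2 * n + 1)). assert (H3 := wallis_decr (S (2 * n + 1))).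
  assert (H4 := wallis_rec (2 * n + 1)).
  replace (S (S (2 * n + 1))) with (2 * n + 1 + 2)%nat in H3 by lia.
  rewrite !plus_INR, mult_INR in H4. change (INR 2) with 2 in *. change (INR 1) with 1 in *.
  assert (Hn := pos_INR n).
  set (w := wallis (2 * n + 1)) in *. set (l := log_wallis (2 * n + 1)) in *.
  set (w1 := wallis (S (2 * n + 1))) in *. set (w2 := wallis (2 * n + 1 + 2)) in *.
  split.
  + apply (Rmult_le_reg_r w); [exact Hp|].
    replace (l / w * w) with l by (field; lra).
    eapply Rle_trans; [|exact H1].
    rewrite Rmult_minus_distr_r. apply Rplus_le_compat_l, Ropp_le_contravar.
    apply (Rmult_le_reg_l (2 * INR n + 3)); [lra|].
    replace ((2 * INR n + 3) * (/ (2 * INR n + 3) * w)) with w by (field; lra).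
    assert ((2 * INR n + 3) * w2 <= (2 * INR n + 3) * w1) by (apply Rmult_le_compat_l; lra). lra.
  + apply (Rmult_le_reg_r w); [exact Hp|].
    replace (l / w * w) with l by (field; lra). exact H2.
- replace (Finite (ln 2)) with (Rbar_minus (ln 2) 0) by (simpl; f_equal; ring).
  apply (is_lim_seq_minus _ _ (ln 2) 0); [apply is_lim_seq_const|apply lim_inv_affine; lra|].
  reflexivity.
- apply is_lim_seq_const.
Qed.

Definition harmonic (n : nat) : R := sum_below (fun k => / INR (S k)) n.

Lemma ln_step x : 0 < x -> / (x + 1) <= ln (x + 1) - ln x <= / x.
Proof.
intros Hx.
assert (H : forall y, 0 < y -> ln y <= y - 1).
{ intros y Hy. rewrite <- (ln_exp (y - 1)). apply Rcomplements.ln_le; [exact Hy|].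
  assert (H := exp_ineq1_le (y - 1)). lra. }
assert (H1 := H ((x + 1) / x)). assert (H2 := H (x / (x + 1))).
rewrite ln_div in H1, H2 by lra.
assert (E1 : (x + 1) / x - 1 = / x) by (field; lra).
assert (E2 : x / (x + 1) - 1 = - / (x + 1)) by (field; lra).
rewrite E1 in H1. rewrite E2 in H2.
assert (0 < (x + 1) / x) by (apply Rdiv_lt_0_compat; lra).
assert (0 < x / (x + 1)) by (apply Rdiv_lt_0_compat; lra).
specialize (H1 ltac:(assumption)). specialize (H2 ltac:(assumption)). lra.
Qed.

Lemma euler_gamma_lim :
  is_lim_seq (fun n => harmonic (S n) - ln (INR (S n))) euler_gamma.
Proof.
set (u := fun n : nat => harmonic n - ln (INR n)).
assert (Hu : euler_gamma = real (Lim_seq u)).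
{ unfold euler_gamma. f_equal. apply Lim_seq_ext. intros n. unfold u.
  f_equal. apply sum_below_sum_n_m. }
assert (Hex : ex_finite_lim_seq (fun n => u (S n))).
{ apply (ex_finite_lim_seq_decr _ 0).
  - intros n. unfold u, harmonic. cbn [sum_below].
    assert (H := ln_step (INR (S n))). rewrite (S_INR (S n)).
    assert (0 < INR (S n)) by (apply lt_0_INR; lia). specialize (H ltac:(assumption)). lra.
  - assert (H : forall n, ln (INR (S n)) <= harmonic n).
    { induction n as [|n IH]; [unfold harmonic; simpl; rewrite ln_1; lra|].
      unfold harmonic in *. cbn [sum_below].
      assert (H := ln_step (INR (S n))). rewrite (S_INR (S n)).
      assert (0 < INR (S n)) by (apply lt_0_INR; lia). specialize (H ltac:(assumption)). lra. }
    intros n. specialize (H n). unfold u, harmonic in *. cbn [sum_below].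
    assert (0 < / INR (S n)) by (apply Rinv_0_lt_compat, lt_0_INR; lia). lra. }
rewrite Hu, <- Lim_seq_incr_1. apply Lim_seq_correct', Hex.
Qed.

Lemma odd_harmonic n :
  sum_below (fun k => 2 / (2 * INR k + 1)) n = 2 * harmonic (2 * n) - harmonic n.
Proof.
induction n as [|n IH]; [unfold harmonic; simpl; ring|].
replace (2 * S n)%nat with (S (S (2 * n))) by lia.
unfold harmonic in *. cbn [sum_below]. rewrite IH, !S_INR, mult_INR. change (INR 2) with 2.
assert (H := pos_INR n). field. lra.
Qed.

Lemma landau_lim :
  is_lim_seq (fun n => PI * landau n - ln (INR n + 3 / 4)) (euler_gamma + 4 * ln 2).
Proof.
apply (is_lim_seq_ext (fun n =>
  2 * (log_wallis (2 * n + 1) / wallis (2 * n + 1))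
  + 2 * (harmonic (S (2 * n + 1)) - ln (INR (S (2 * n + 1))))
  + -1 * (harmonic (S n) - ln (INR (S n)))
  + 2 * ln 2 + (ln (INR (S n)) - ln (INR n + 3 / 4)))).
{ intros n. rewrite landau_log_wallis, odd_harmonic.
  replace (2 * S n)%nat with (S (2 * n + 1)) by lia.
  replace (INR (S (2 * n + 1))) with (2 * INR (S n)).
  2:{ rewrite !S_INR, plus_INR, mult_INR. simpl. ring. }
  rewrite ln_mult; [ring|lra|apply lt_0_INR; lia]. }
replace (Finite (euler_gamma + 4 * ln 2)) with
  (Finite (2 * ln 2 + 2 * euler_gamma + -1 * euler_gamma + 2 * ln 2 + 0)) by (f_equal; ring).
assert (Hg := euler_gamma_lim).
repeat apply is_lim_seq_plus'.
- apply (is_lim_seq_scal_l _ 2 (ln 2)), log_wallis_lim.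
- apply (is_lim_seq_scal_l _ 2 euler_gamma).
  apply (is_lim_seq_subseq _ _ (fun n => (2 * n + 1)%nat)) in Hg; [exact Hg|].
  apply eventually_subseq. intros n. lia.
- apply (is_lim_seq_scal_l _ (-1) euler_gamma), Hg.
- apply is_lim_seq_const.
- apply (is_lim_seq_le_le (fun _ => 0) _ (fun n => / (1 * INR n + 3 / 4))).
  + intros n. assert (H := pos_INR n).
    assert (Hs := ln_step (INR n + 3 / 4)). rewrite S_INR.
    assert (ln (INR n + 3 / 4) <= ln (INR n + 1)) by (apply Rcomplements.ln_le; lra).
    assert (ln (INR n + 1) <= ln (INR n + 3 / 4 + 1)) by (apply Rcomplements.ln_le; lra).
    rewrite Rmult_1_l. split; [lra|]. apply Rle_trans with (ln (INR n + 3 / 4 + 1) - ln (INR n + 3 / 4)); [lra|].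
    apply Hs. lra.
  + apply is_lim_seq_const.
  + apply lim_inv_affine. lra.
Qed.

(** * The expansion of the steps of PI * G_n *)

Lemma seq_decr_pos (s : nat -> R) :
  (forall n, s (S n) < s n) -> is_lim_seq s 0 -> forall n, 0 < s n.
Proof.
intros Hd Hl n.
assert (Hle : forall k, s (k + S n)%nat <= s (S n)).
{ induction k as [|k IH]; [right; reflexivity|]. specialize (Hd (k + S n)%nat). simpl. lra. }
assert (H0 : Rbar_le 0 (s (S n))).
{ apply (is_lim_seq_le (fun k => s (k + S n)%nat) (fun _ => s (S n))); [exact Hle| |apply is_lim_seq_const].
  apply -> (is_lim_seq_incr_n s (S n)). exact Hl. }
simpl in H0. specialize (Hd n). lra.
Qed.

Lemma lim_inv_pow b k : is_lim_seq (fun n => / (INR n + b) ^ S k) 0.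
Proof.
apply (is_lim_seq_ext (fun n => (/ (1 * INR n + b)) ^ S k)).
{ intros n. rewrite Rmult_1_l. apply pow_inv. }
induction k as [|k IH].
- apply (is_lim_seq_ext (fun n => / (1 * INR n + b))); [intros; ring|]. apply lim_inv_affine; lra.
- replace (Finite 0) with (Finite (0 * 0)) by (f_equal; ring).
  apply (is_lim_seq_mult' (fun n => / (1 * INR n + b))); [apply lim_inv_affine; lra|exact IH].
Qed.

Lemma landau_step_S n :
  (INR n + 1 / 4 + 3 / 4) ^ 2 * landau_step (S n) = (INR n + 1 / 4 + 1 / 4) ^ 2 * landau_step n.
Proof.
unfold landau_step.
change (odd_even_ratio (S n)) with (odd_even_ratio n * (INR (2 * S n - 1) / INR (2 * S n))).
replace (2 * S n - 1)%nat with (2 * n + 1)%nat by lia.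
rewrite plus_INR, !mult_INR. change (INR 2) with 2. change (INR 1) with 1. rewrite S_INR.
assert (H := pos_INR n). field. lra.
Qed.

Lemma leg_trunc_lim p :
  is_lim_seq (fun n => leg_trunc (S p) (INR n + 1 / 4) * (2 * INR n + 1)) 2.
Proof.
assert (Hterm : is_lim_seq (fun n => (2 * INR n + 1) / (INR n + 1 / 4)) 2).
{ apply (is_lim_seq_ext (fun n => 2 + / 2 * / (INR n + 1 / 4) ^ 1)).
  { intros n. assert (H := pos_INR n). field. lra. }
  replace (Finite 2) with (Finite (2 + / 2 * 0)) by (f_equal; ring).
  apply is_lim_seq_plus'; [apply is_lim_seq_const|].
  apply (is_lim_seq_scal_l _ (/ 2) 0), lim_inv_pow. }
induction p as [|p IH].
- eapply is_lim_seq_ext; [|exact Hterm].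
  intros n. unfold leg_trunc. simpl. rewrite leg_ser_0.
  assert (H := pos_INR n). field. lra.
- apply (is_lim_seq_ext (fun n => leg_trunc (S p) (INR n + 1 / 4) * (2 * INR n + 1)
    + leg_ser (S p) * INR (fact (2 * S p)) * ((2 * INR n + 1) / (INR n + 1 / 4) * / (INR n + 1 / 4) ^ (2 * S p)))).
  { intros n. change (leg_trunc (S (S p)) (INR n + 1 / 4)) with (leg_trunc (S p) (INR n + 1 / 4)
      + leg_ser (S p) * (INR (fact (2 * S p)) / (INR n + 1 / 4) ^ (2 * S p + 1))).
    replace (2 * S p + 1)%nat with (S (2 * S p)) by lia.
    rewrite <- (tech_pow_Rmult _ (2 * S p)).
    assert (H := pos_INR n).
    assert (Hy : 0 < (INR n + 1 / 4) ^ (2 * S p)) by (apply pow_lt; lra).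
    set (y := (INR n + 1 / 4) ^ (2 * S p)) in *. field. repeat split; lra. }
  replace (Finite 2) with (Finite (2 + leg_ser (S p) * INR (fact (2 * S p)) * (2 * 0))) by (f_equal; ring).
  apply is_lim_seq_plus'; [exact IH|].
  apply (is_lim_seq_scal_l _ (leg_ser (S p) * INR (fact (2 * S p))) (2 * 0)).
  apply is_lim_seq_mult'; [exact Hterm|].
  replace (2 * S p)%nat with (S (2 * p + 1)) by lia. apply lim_inv_pow.
Qed.

Lemma landau_step_lim : is_lim_seq (fun n => (2 * INR n + 1) * landau_step n) 2.
Proof.
apply (is_lim_seq_le_le (fun _ => 2) _ (fun n => 2 * (1 + / (2 * INR n + 1)))).
- apply landau_step_bounds.
- apply is_lim_seq_const.
- replace (Finite 2) with (Finite (2 * (1 + 0))) by (f_equal; ring).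
  apply (is_lim_seq_scal_l _ 2 (1 + 0)).
  apply is_lim_seq_plus'; [apply is_lim_seq_const|apply lim_inv_affine; lra].
Qed.

(** The ratio of [leg_trunc] to the step is monotone, since the steps satisfy
    exactly the recurrence that [leg_trunc] satisfies up to an error of known
    sign ([leg_trunc_step]); its limit is 1. *)
Lemma landau_step_envelope m n :
  0 < (-1) ^ m * (landau_step n - leg_trunc m (INR n + 1 / 4)).
Proof.
destruct m as [|p].
{ unfold leg_trunc. simpl. assert (H := landau_step_pos n). lra. }
set (s := fun n => (-1) ^ S p * (1 - leg_trunc (S p) (INR n + 1 / 4) / landau_step n)).
assert (Hs : 0 < s n).
{ apply seq_decr_pos.
  - intros k. assert (Hk := pos_INR k). assert (HM : 0 < INR k + 1 / 4) by lra.
    assert (H := leg_trunc_step p _ HM).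
    assert (H2 := landau_step_S k).
    assert (Hp := landau_step_pos k). assert (Hp' := landau_step_pos (S k)).
    unfold s. rewrite S_INR. replace (INR k + 1 + 1 / 4) with (INR k + 1 / 4 + 1) by ring.
    set (M := INR k + 1 / 4) in *.
    assert (Hc : 0 < (M + 1 / 4) ^ 2 * landau_step k).
    { apply Rmult_lt_0_compat; [apply pow_lt; lra|exact Hp]. }
    apply Rlt_0_minus.
    apply (Rmult_lt_reg_l _ _ _ Hc). rewrite Rmult_0_r.
    replace ((M + 1 / 4) ^ 2 * landau_step k *
      ((-1) ^ S p * (1 - leg_trunc (S p) M / landau_step k) -
       (-1) ^ S p * (1 - leg_trunc (S p) (M + 1) / landau_step (S k))))
    with ((-1) ^ p * ((M + 1 / 4) ^ 2 * leg_trunc (S p) M -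
        ((M + 1 / 4) ^ 2 * landau_step k) * (leg_trunc (S p) (M + 1) / landau_step (S k))))
      by (simpl; field; lra).
    rewrite <- H2.
    replace ((M + 3 / 4) ^ 2 * landau_step (S k) * (leg_trunc (S p) (M + 1) / landau_step (S k)))
      with ((M + 3 / 4) ^ 2 * leg_trunc (S p) (M + 1)) by (field; lra).
    exact H.
  - unfold s.
    replace (Finite 0) with (Rbar_mult ((-1) ^ S p) (1 - 2 / 2)) by (simpl; f_equal; field).
    apply (is_lim_seq_scal_l (fun n => 1 - leg_trunc (S p) (INR n + 1 / 4) / landau_step n)).
    apply is_lim_seq_minus'; [apply is_lim_seq_const|].
    apply (is_lim_seq_ext (fun n => (leg_trunc (S p) (INR n + 1 / 4) * (2 * INR n + 1)) / ((2 * INR n + 1) * landau_step n))).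
    { intros k. assert (H := pos_INR k). assert (Hp := landau_step_pos k). field. lra. }
    apply is_lim_seq_div'; [apply leg_trunc_lim|apply landau_step_lim|lra]. }
assert (Hp := landau_step_pos n).
replace ((-1) ^ S p * (landau_step n - leg_trunc (S p) (INR n + 1 / 4))) with (landau_step n * s n).
- apply Rmult_lt_0_compat; assumption.
- unfold s. field. lra.
Qed.

(** * Central differences of ln and of even powers *)

(** Minus the Laplace transform of u^(2s-1); for s = 0 this is a regularised
    transform of 1/u. *)
Definition log_pow (s : nat) (N : R) : R :=
  match s with O => ln N | S _ => - INR (fact (2 * s - 1)) / N ^ (2 * s) end.

(** The Laplace transform of u^(p+1) (1 - (2/u) sinh (u/2) T(u)), where T is the
    truncation of [csch_ser] to m terms. *)
Definition csch_defect (p m : nat) (M : R) : R :=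
  INR (fact (S p)) / M ^ S (S p)
  - sum_below (fun k => csch_ser k * (INR (fact (p + 2 * k)) / (M - 1 / 2) ^ S (p + 2 * k)
     - INR (fact (p + 2 * k)) / (M + 1 / 2) ^ S (p + 2 * k))) m.

Lemma csch_defect_sign p m M : 1 / 2 < M -> 0 < (-1) ^ m * csch_defect p m M.
Proof.
intros HM. assert (H1 : 0 < M - 1 / 2) by lra. assert (H2 : 0 < M + 1 / 2) by lra.
assert (H3 : 0 < M) by lra.
assert (Hl := laplace_sum csch_ser (fun k u => two_sinh u * u ^ (p + 2 * k)) M _ m
  (fun k _ => laplace_two_sinh _ _ _ _ (laplace_pow (p + 2 * k) _ H1) (laplace_pow (p + 2 * k) _ H2))).
assert (H := laplace_scal ((-1) ^ m) _ _ _ (laplace_plus _ _ _ _ _ (laplace_pow (S p) _ H3) (laplace_scal (-1) _ _ _ Hl))).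
apply laplace_pos in H.
- evar_last; [exact H|]. unfold csch_defect. ring.
- intros u Hu. cbv beta.
  replace (u ^ S p + -1 * sum_below (fun i => csch_ser i * (two_sinh u * u ^ (p + 2 * i))) m) with
   (u ^ S p * (1 - two_sinh u / u * trunc csch_ser m (u ^ 2))).
  + rewrite <- Rmult_assoc, (Rmult_comm ((-1) ^ m)), Rmult_assoc.
    apply Rmult_lt_0_compat; [apply pow_lt, Hu|apply csch_trunc_sign, Hu].
  + rewrite (sum_below_ext _ (fun i => two_sinh u * u ^ p * (csch_ser i * (u ^ 2) ^ i))).
    * rewrite sum_below_scal. unfold trunc. simpl pow. field. lra.
    * intros i _. rewrite pow_add, pow_mult. ring.
Qed.

Lemma inv_pow_derive c m N : 0 < N ->
  is_derive (fun x => c / x ^ m) N (- INR m * c / N ^ S m).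
Proof.
intros HN. assert (Hp : 0 < N ^ m) by (apply pow_lt, HN).
auto_derive; [lra|]. destruct m as [|m]; [simpl; field; lra|].
simpl pred. change (N ^ S (S m)) with (N * (N * N ^ m)). change (N ^ S m) with (N * N ^ m).
assert (0 < N ^ m) by (apply pow_lt, HN). field. lra.
Qed.

Lemma log_pow_derive k N : 0 < N ->
  is_derive (log_pow k) N (INR (fact (2 * k)) / N ^ S (2 * k)).
Proof.
intros HN. destruct k as [|k]; unfold log_pow.
- auto_derive; [exact HN|]. simpl. field. lra.
- replace (2 * S k - 1)%nat with (S (2 * k)) by lia.
  replace (2 * S k)%nat with (S (S (2 * k))) by lia.
  evar_last; [apply (inv_pow_derive (- INR (fact (S (2 * k)))) _ N HN)|].
  rewrite (fact_simpl (S (2 * k))), mult_INR. unfold Rdiv. ring.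
Qed.

Lemma log_pow_diff_lim k b : 1 / 2 < b ->
  is_lim_seq (fun n => log_pow k (INR n + b + 1 / 2) - log_pow k (INR n + b - 1 / 2)) 0.
Proof.
intros Hb. destruct k as [|k]; unfold log_pow.
- apply (is_lim_seq_le_le (fun _ => 0) _ (fun n => / (INR n + (b - 1 / 2)) ^ 1)).
  + intros n. assert (H := pos_INR n).
    assert (Hs := ln_step (INR n + b - 1 / 2)).
    replace (INR n + b - 1 / 2 + 1) with (INR n + b + 1 / 2) in Hs by field.
    replace ((INR n + (b - 1 / 2)) ^ 1) with (INR n + b - 1 / 2) by ring.
    assert (0 < / (INR n + b + 1 / 2)) by (apply Rinv_0_lt_compat; lra).
    specialize (Hs ltac:(lra)). lra.
  + apply is_lim_seq_const.
  + apply lim_inv_pow.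
- replace (Finite 0) with (Finite (- INR (fact (2 * S k - 1)) * 0 - - INR (fact (2 * S k - 1)) * 0)) by (f_equal; ring).
  apply is_lim_seq_minus'; apply (is_lim_seq_scal_l _ _ 0);
   replace (2 * S k)%nat with (S (2 * k + 1)) by lia.
  + apply (is_lim_seq_ext (fun n => / (INR n + (b + 1 / 2)) ^ S (2 * k + 1))); [|apply lim_inv_pow].
    intros n. do 2 f_equal. ring.
  + apply (is_lim_seq_ext (fun n => / (INR n + (b - 1 / 2)) ^ S (2 * k + 1))); [|apply lim_inv_pow].
    intros n. do 2 f_equal. ring.
Qed.

(** For i > 0 this is [csch_defect_sign].  For i = 0 the term ln N has no
    convergent Laplace integral; but minus the derivative in M is
    [csch_defect] with p = 0, and the expression tends to 0 at infinity. *)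
Lemma midpoint_sign i m M : 1 / 2 < M ->
  0 < (-1) ^ m * (INR (fact (2 * i)) / M ^ (2 * i + 1)
    - sum_below (fun k => csch_ser k * (log_pow (i + k) (M + 1 / 2) - log_pow (i + k) (M - 1 / 2))) m).
Proof.
intros HM. destruct i as [|i].
- set (F := fun x => (-1) ^ m * (/ x
    - sum_below (fun k => csch_ser k * (log_pow k (x + 1 / 2) - log_pow k (x - 1 / 2))) m)).
  assert (HF : forall x, 1 / 2 < x -> is_derive F x (- ((-1) ^ m * csch_defect 0 m x))).
  { intros x Hx. unfold F. evar_last.
    - apply (is_derive_scal (fun x => / x
       - sum_below (fun k => csch_ser k * (log_pow k (x + 1 / 2) - log_pow k (x - 1 / 2))) m)).
      apply (is_derive_minus (fun x => / x) (fun x => sum_below (fun k => csch_ser k * (log_pow k (x + 1 / 2) - log_pow k (x - 1 / 2))) m)).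
      + apply (is_derive_inv (fun x => x)); [apply (is_derive_id (K := R_AbsRing))|lra].
      + apply (is_derive_sum_below (fun k x => csch_ser k * (log_pow k (x + 1 / 2) - log_pow k (x - 1 / 2)))
          (fun k x => csch_ser k * (INR (fact (2 * k)) / (x + 1 / 2) ^ S (2 * k) - INR (fact (2 * k)) / (x - 1 / 2) ^ S (2 * k)))).
        intros k _. apply (is_derive_scal (fun x => log_pow k (x + 1 / 2) - log_pow k (x - 1 / 2))).
        apply (is_derive_minus (fun x => log_pow k (x + 1 / 2)) (fun x => log_pow k (x - 1 / 2))).
        * evar_last.
          -- apply (is_derive_comp (log_pow k) (fun x => x + 1 / 2)); [apply log_pow_derive; lra|].
             auto_derive; [exact I|reflexivity].
          -- apply Rmult_1_l.
        * evar_last.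
          -- apply (is_derive_comp (log_pow k) (fun x => x - 1 / 2)); [apply log_pow_derive; lra|].
             auto_derive; [exact I|reflexivity].
          -- apply Rmult_1_l.
    - unfold csch_defect. unfold minus, plus, opp, one.
      generalize csch_ser as c; intros c. cbn -[INR pow sum_below fact Nat.mul].
      rewrite (sum_below_ext _ (fun k => -1 * (c k * (INR (fact (2 * k)) / (x - 1 / 2) ^ S (2 * k) - INR (fact (2 * k)) / (x + 1 / 2) ^ S (2 * k))))) by (intros; unfold Rdiv; ring).
      rewrite sum_below_scal. change (INR (fact 1)) with 1. field. lra. }
  assert (HM0 : 0 < (fun n => F (INR n + M)) O).
  { apply (seq_decr_pos (fun n => F (INR n + M))).
    - intros n. assert (Hn := pos_INR n).
      destruct (MVT_cor2 F (fun x => - ((-1) ^ m * csch_defect 0 m x)) (INR n + M) (INR (S n) + M)) as [c [Hc1 Hc2]].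
      + rewrite S_INR. lra.
      + intros c Hc. apply is_derive_Reals, HF. lra.
      + assert (H := csch_defect_sign 0 m c ltac:(lra)). rewrite S_INR in *.
        replace (INR n + 1 + M - (INR n + M)) with 1 in Hc1 by ring. lra.
    - unfold F.
      replace (Finite 0) with (Rbar_mult ((-1) ^ m) (0 - 0)) by (simpl; f_equal; ring).
      apply (is_lim_seq_scal_l (fun n => / (INR n + M) - sum_below (fun k => csch_ser k * (log_pow k (INR n + M + 1 / 2) - log_pow k (INR n + M - 1 / 2))) m)).
      apply is_lim_seq_minus'.
      + apply (is_lim_seq_ext (fun n => / (INR n + M) ^ 1)); [|apply lim_inv_pow].
        intros n. f_equal. ring.
      + clear F HF. induction m as [|m IH]; simpl; [apply is_lim_seq_const|].
        replace (Finite 0) with (Finite (0 + csch_ser m * 0)) by (f_equal; ring).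
        apply is_lim_seq_plus'; [exact IH|].
        apply (is_lim_seq_scal_l _ _ 0). apply log_pow_diff_lim, HM. }
  evar_last; [exact HM0|]. unfold F. simpl INR. rewrite Rplus_0_l. simpl. f_equal. f_equal. field. lra.
- evar_last; [apply (csch_defect_sign (2 * i + 1) m M HM)|].
  unfold csch_defect. f_equal.
  replace (2 * S i + 1)%nat with (S (S (2 * i + 1))) by lia.
  replace (2 * S i)%nat with (S (2 * i + 1)) by lia. f_equal.
  apply sum_below_ext; intros k _. unfold log_pow.
  simpl (S i + k)%nat. replace (2 * S (i + k) - 1)%nat with (2 * i + 1 + 2 * k)%nat by lia.
  replace (2 * S (i + k))%nat with (S (2 * i + 1 + 2 * k)) by lia.
  unfold Rdiv. ring.
Qed.

(** * Sign of the error term *)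

(** ln N + beta_2 / N^2 + ... up to the index l - 1. *)
Definition expansion (l : nat) (N : R) : R := sum_below (fun s => kernel_ser s * log_pow s N) l.

(** As [kernel_ser] is a product, the difference of [expansion] is a truncated
    composition: expand the step in powers of 1/M, then each of the first l
    powers in central differences, to the complementary order. *)
Lemma expansion_diff_sign l n :
  0 < (-1) ^ l * (landau_step (S n) - (expansion l (INR (S n) + 3 / 4) - expansion l (INR n + 3 / 4))).
Proof.
set (M := INR (S n) + 1 / 4).
assert (Hn := pos_INR n).
assert (HM : 1 / 2 < M) by (unfold M; rewrite S_INR; lra).
replace (INR (S n) + 3 / 4) with (M + 1 / 2) by (unfold M; field).
replace (INR n + 3 / 4) with (M - 1 / 2) by (unfold M; rewrite S_INR; field).
assert (Hd : expansion l (M + 1 / 2) - expansion l (M - 1 / 2) =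
  sum_below (fun i => leg_ser i * sum_below (fun k => csch_ser k *
     (log_pow (i + k) (M + 1 / 2) - log_pow (i + k) (M - 1 / 2))) (l - i)) l).
{ rewrite <- (sum_below_conv leg_ser csch_ser (fun s => log_pow s (M + 1 / 2) - log_pow s (M - 1 / 2))).
  unfold expansion. fold kernel_ser.
  rewrite (sum_below_ext (fun s => kernel_ser s * (log_pow s (M + 1 / 2) - log_pow s (M - 1 / 2)))
   (fun s => kernel_ser s * log_pow s (M + 1 / 2) + -1 * (kernel_ser s * log_pow s (M - 1 / 2)))) by (intros; ring).
  rewrite sum_below_plus, sum_below_scal. ring. }
rewrite Hd.
replace ((-1) ^ l * (landau_step (S n) - sum_below (fun i => leg_ser i * sum_below (fun k => csch_ser k *
     (log_pow (i + k) (M + 1 / 2) - log_pow (i + k) (M - 1 / 2))) (l - i)) l)) with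
 ((-1) ^ l * (landau_step (S n) - leg_trunc l M) +
  sum_below (fun i => ((-1) ^ i * leg_ser i) * ((-1) ^ (l - i) * (INR (fact (2 * i)) / M ^ (2 * i + 1)
    - sum_below (fun k => csch_ser k *
     (log_pow (i + k) (M + 1 / 2) - log_pow (i + k) (M - 1 / 2))) (l - i)))) l).
- apply Rplus_lt_le_0_compat; [apply landau_step_envelope|].
  apply sum_below_ge0. intros i Hi. apply Rmult_le_pos; apply Rlt_le.
  + apply leg_alternating.
  + apply midpoint_sign, HM.
- rewrite (sum_below_ext _ (fun i => (-1) ^ l * (leg_ser i * (INR (fact (2 * i)) / M ^ (2 * i + 1)))
    + - (-1) ^ l * (leg_ser i * sum_below (fun k => csch_ser k *
     (log_pow (i + k) (M + 1 / 2) - log_pow (i + k) (M - 1 / 2))) (l - i)))).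
  + rewrite sum_below_plus, !sum_below_scal. unfold leg_trunc. ring.
  + intros i Hi. rewrite (pow_m1_split i l) by lia. ring.
Qed.

Lemma epsilon_expansion l n : (1 <= l)%nat ->
  epsilon l n = PI * landau n - euler_gamma - 4 * ln 2 - expansion l (INR n + 3 / 4).
Proof.
intros Hl. destruct l as [|l]; [lia|].
unfold epsilon, expansion. rewrite sum_below_shift.
replace (S l - 1)%nat with l by lia. rewrite sum_below_sum_n_m.
rewrite (sum_below_ext (fun i => beta (S i) / (INR n + 3 / 4) ^ (2 * S i))
  (fun i => kernel_ser (S i) * log_pow (S i) (INR n + 3 / 4))).
- rewrite kernel_ser_0. simpl log_pow at 2. ring.
- intros i _. rewrite beta_kernel by lia. unfold log_pow, Rdiv. ring.
Qed.

Lemma epsilon_lim l : (1 <= l)%nat -> is_lim_seq (epsilon l) 0.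
Proof.
intros Hl. destruct l as [|l]; [lia|].
unfold epsilon. replace (S l - 1)%nat with l by lia.
apply (is_lim_seq_ext (fun n => (PI * landau n - ln (INR n + 3 / 4)) - (euler_gamma + 4 * ln 2)
  - sum_below (fun i => beta (S i) * / (INR n + 3 / 4) ^ (2 * S i)) l)).
{ intros n. cbv zeta. rewrite sum_below_sum_n_m. unfold Rdiv. ring. }
replace (Finite 0) with (Finite (euler_gamma + 4 * ln 2 - (euler_gamma + 4 * ln 2) - 0)) by (f_equal; ring).
apply is_lim_seq_minus'; [apply is_lim_seq_minus'; [apply landau_lim|apply is_lim_seq_const]|].
clear Hl. induction l as [|l IH]; simpl sum_below; [apply is_lim_seq_const|].
replace (Finite 0) with (Finite (0 + beta (S l) * 0)) by (f_equal; ring).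
apply is_lim_seq_plus'; [exact IH|]. apply (is_lim_seq_scal_l _ _ 0).
replace (2 * S l)%nat with (S (2 * l + 1)) by lia. apply lim_inv_pow.
Qed.

Theorem theorem1 : forall (l n : nat),
  (1 <= l)%nat -> (-1) ^ (l + 1) * epsilon l n > 0.
Proof.
intros l n Hl.
apply (seq_decr_pos (fun n => (-1) ^ (l + 1) * epsilon l n)).
- intros k. rewrite !epsilon_expansion by exact Hl. rewrite landau_S.
  assert (H := expansion_diff_sign l k). unfold landau_step in H.
  replace (l + 1)%nat with (S l) by lia. simpl ((-1) ^ S l). lra.
- replace (Finite 0) with (Rbar_mult ((-1) ^ (l + 1)) 0) by (simpl; f_equal; ring).
  apply (is_lim_seq_scal_l (epsilon l)), epsilon_lim, Hl.
Qed.
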